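(* The category $\mathfrak{IGR}$ of GR spaces with involution and the category $\mathfrak{IBSL}$ of involutive bisemilattices are dually equivalent.
   Context: Conventions: two categories are dually equivalent if there are contravariant functors $\mathcal F:\mathfrak C\to\mathfrak D$, $\mathcal G:\mathfrak D\to\mathfrak C$ with $\mathcal G\circ\mathcal F=\mathrm{id}_{\mathfrak C}$ and $\mathcal F\circ\mathcal G=\mathrm{id}_{\mathfrak D}$. Involutive bisemilattice: an algebra $\langle B,\cdot,+,{}',0,1\rangle$ of type $(2,2,1,0,0)$ satisfying $x+x\approx x$; $x+y\approx y+x$; $x+(y+z)\approx(x+y)+z$; $(x')'\approx x$; $x\cdot y\approx(x'+y')'$; $x\cdot(x'+y)\approx x\cdot y$; $0+x\approx x$; $1\approx 0'$. $\mathfrak{IBSL}$: involutive bisemilattices with homomorphisms. A left normal band is a semigroup $\langle A,\ast\rangle$ with $x\ast x=x$ and $x\ast(y\ast z)=x\ast(z\ast y)$. A partially ordered left normal band is $\langle A,\ast,\le\rangle$ with $\langle A,\ast\rangle$ a left normal band, $\le$ a partial order, $x\le y$ implying $x\ast z\le y\ast z$ and $z\ast x\le z\ast y$, and $x\ast y\le x$. Put $a\sqsubseteq b$ iff $a\ast b\le b$ and $b\ast a=b$. With constants $c_0,c_1,c_\alpha$ one requires: $x\ast c_\alpha=c_\alpha\ast x=c_\alpha$; $x\ast c_0=x\ast c_1=x$; $c_0\sqsubseteq x\le c_1$ and $c_\alpha\le x\sqsubseteq c_\alpha$ for all $x$; $c_0\ast x=c_1\ast x$ implies $x=c_\alpha$.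 A GR space is such a structure with a topology $\tau$ such that $\ast:A\times A\to A$ is continuous and $\langle A,\le,\tau\rangle$ is compact and totally order disconnected ($\{(a,b):a\le b\}$ is closed in $A\times A$, and if $a\not\le b$ there is a clopen lower set $U$ with $b\in U$, $a\notin U$). GR morphisms are continuous maps preserving $\ast$, the constants and $\le$. The algebra $\mathbf 3$ has universe $\{0,1,\alpha\}$ with the weak Kleene operations: $x\cdot y=x+y=\alpha$ if $x=\alpha$ or $y=\alpha$, and otherwise $\cdot,+$ are the Boolean meet and join on $\{0,1\}$; $0'=1$, $1'=0$, $\alpha'=\alpha$. Write $x\le_\cdot y$ iff $x\cdot y=x$ (so $\alpha<0<1$) and $x\le_+ y$ iff $x+y=y$. $\mathbf 3$ is a GR space with the discrete topology, $\le\,=\,\le_\cdot$, $c_0=0,c_1=1,c_\alpha=\alpha$, and $a\ast b=a$ if $b\ne\alpha$, $a\ast b=\alpha$ if $b=\alpha$. For a GR space $\mathbf A$, $\mathrm{Hom}_{GR}(\mathbf A,\mathbf 3)$ is the set of GR morphisms into $\mathbf 3$, with pointwise operations $\cdot,+$. A GR space with involution is a GR space $\mathbf G$ with a continuous map $\neg:G\to G$ such that for all $a,b$: (G1) $\neg\neg a=a$; (G2) $\neg(a\ast b)=\neg a\ast\neg b$; (G3) $a\le b$ implies $\neg b\sqsubseteq\neg a$; (G4) $\neg c_0=c_1$, $\neg c_1=c_0$, $\neg c_\alpha=c_\alpha$; (G5) on $\mathrm{Hom}_{GR}(\mathbf G,\mathbf 3)$ with $(\neg\varphi)(a)=(\varphi(\neg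 a))'$ one has $\varphi\cdot(\neg\varphi+\psi)=\psi\cdot\varphi$ for all $\varphi,\psi$ (operations pointwise); (G6) there exist $\varphi_0,\varphi_1\in\mathrm{Hom}_{GR}(\mathbf G,\mathbf 3)$ with $\neg\varphi_0=\varphi_1$ and $\varphi+\varphi_0=\varphi$ for all $\varphi$. $\mathfrak{IGR}$ is the category of GR spaces with involution whose morphisms are GR morphisms preserving $\neg$.
   Formalization: False as stated if homomorphisms fix 0 and 1. Proved instead: IGR is dual to IBSL with maps preserving only ·, +, ′; and IBSL with all homomorphisms is dual to IGR with morphisms pulling φ₀ back to φ₀. Composites are the identity up to natural isomorphism. *)

(* Defs.v *)
From HB Require Import structures.
From mathcomp Require Import all_boot all_order all_classical.
From mathcomp Require Import topology_structure product_topology compact.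
From mathcomp Require Import discrete_topology.

Set Implicit Arguments.
Unset Strict Implicit.
Unset Printing Implicit Defensive.

Local Open Scope classical_set_scope.

(** * Categories and dual equivalence *)

Record category := Category {
  obj :> Type;
  hom : obj -> obj -> Type;
  idm : forall a, hom a a;
  compm : forall a b c, hom b c -> hom a b -> hom a c;
  compmA : forall a b c d (h : hom c d) (g : hom b c) (f : hom a b),
    compm h (compm g f) = compm (compm h g) f;
  comp1m : forall a b (f : hom a b), compm (idm b) f = f;
  compm1 : forall a b (f : hom a b), compm f (idm a) = f }.

Record functor (C D : category) := Functor {
  fobj :> C -> D;
  fmap : forall a b : C, hom a b -> hom (fobj a) (fobj b);
  fmap_id : forall a : C, fmap (idm a) = idm (fobj a);
  fmap_comp : forall (a b c : C) (g : hom b c) (f : hom a b),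
    fmap (compm g f) = compm (fmap g) (fmap f) }.

Record contrafunctor (C D : category) := Contrafunctor {
  cobj :> C -> D;
  cmap : forall a b : C, hom a b -> hom (cobj b) (cobj a);
  cmap_id : forall a : C, cmap (idm a) = idm (cobj a);
  cmap_comp : forall (a b c : C) (g : hom b c) (f : hom a b),
    cmap (compm g f) = compm (cmap f) (cmap g) }.

Definition id_functor (C : category) : functor C C :=
  @Functor C C id (fun a b f => f) (fun a => erefl) (fun a b c g f => erefl).

Section ContraComp.
Variables (C D E : category) (G : contrafunctor D E) (F : contrafunctor C D).

Lemma ccomp_id (a : C) : cmap G (cmap F (idm a)) = idm (G (F a)).
Proof. by rewrite !cmap_id. Qed.

Lemma ccomp_comp (a b c : C) (g : hom b c) (f : hom a b) :
  cmap G (cmap F (compm g f)) =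
  compm (cmap G (cmap F g)) (cmap G (cmap F f)).
Proof. by rewrite !cmap_comp. Qed.

Definition ccomp : functor C E :=
  @Functor C E (fun a => G (F a)) (fun a b f => cmap G (cmap F f))
    ccomp_id ccomp_comp.
End ContraComp.

Definition is_iso (C : category) (a b : C) (f : hom a b) : Prop :=
  exists g : hom b a, compm g f = idm a /\ compm f g = idm b.

Definition naturally_isomorphic (C D : category) (F G : functor C D) : Prop :=
  exists eta : forall a : C, hom (F a) (G a),
    (forall (a b : C) (f : hom a b),
       compm (eta b) (fmap F f) = compm (fmap G f) (eta a)) /\
    (forall a : C, is_iso (eta a)).

(* The two composites are the identities up to natural isomorphism. *)
Definition dually_equivalent (C D : category) : Prop :=
  exists (F : contrafunctor C D) (G : contrafunctor D C),
    naturally_isomorphic (ccomp G F) (id_functor C) /\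
    naturally_isomorphic (ccomp F G) (id_functor D).

(* The category of the objects [O], with as arrows from [A] to [B] the functions
   between the carriers that satisfy [P A B]. *)
Section Concrete.
Variables (O : Type) (car : O -> Type).
Variable P : forall A B : O, (car A -> car B) -> Prop.
Hypothesis P_id : forall A, @P A A id.
Hypothesis P_comp : forall A B C (g : car B -> car C) (f : car A -> car B),
  P g -> P f -> P (g \o f).

Let chom (A B : O) := {f : car A -> car B | P f}.
Let cid (A : O) : chom A A := exist _ id (@P_id A).
Let ccompose (A B C : O) (g : chom B C) (f : chom A B) : chom A C :=
  exist _ (sval g \o sval f) (P_comp (proj2_sig g) (proj2_sig f)).

Lemma chom_eq (A B : O) (f g : chom A B) : sval f = sval g -> f = g.
Proof.
case: f g => f Pf [g Pg] /= fg; case: _ / fg Pg => Pg.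
by rewrite (Prop_irrelevance Pf Pg).
Qed.

Lemma ccomposeA (A B C D : O) (h : chom C D) (g : chom B C) (f : chom A B) :
  ccompose h (ccompose g f) = ccompose (ccompose h g) f.
Proof. exact: chom_eq. Qed.

Lemma ccompose1f (A B : O) (f : chom A B) : ccompose (cid B) f = f.
Proof. exact: chom_eq. Qed.

Lemma ccomposef1 (A B : O) (f : chom A B) : ccompose f (cid A) = f.
Proof. exact: chom_eq. Qed.

Definition concrete_category : category :=
  Category ccomposeA ccompose1f ccomposef1.
End Concrete.

(** * Involutive bisemilattices *)

Record ibsl := IBSLAlgebra {
  ib_car :> Type;
  ib_mul : ib_car -> ib_car -> ib_car;
  ib_add : ib_car -> ib_car -> ib_car;
  ib_inv : ib_car -> ib_car;
  ib_zero : ib_car;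
  ib_one : ib_car;
  ib_addxx : forall x, ib_add x x = x;
  ib_addC : forall x y, ib_add x y = ib_add y x;
  ib_addA : forall x y z, ib_add x (ib_add y z) = ib_add (ib_add x y) z;
  ib_invK : forall x, ib_inv (ib_inv x) = x;
  ib_mulE : forall x y, ib_mul x y = ib_inv (ib_add (ib_inv x) (ib_inv y));
  ib_mul_inv_add : forall x y, ib_mul x (ib_add (ib_inv x) y) = ib_mul x y;
  ib_add0x : forall x, ib_add ib_zero x = x;
  ib_oneE : ib_one = ib_inv ib_zero }.

Record is_reduct_hom (A B : ibsl) (h : A -> B) : Prop := IsReductHom {
  rhom_mul : forall x y, h (ib_mul x y) = ib_mul (h x) (h y);
  rhom_add : forall x y, h (ib_add x y) = ib_add (h x) (h y);
  rhom_inv : forall x, h (ib_inv x) = ib_inv (h x) }.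

Record is_ibsl_hom (A B : ibsl) (h : A -> B) : Prop := IsIbslHom {
  hom_reduct : is_reduct_hom h;
  hom_zero : h (ib_zero A) = ib_zero B;
  hom_one : h (ib_one A) = ib_one B }.

Lemma is_reduct_hom_id (A : ibsl) : @is_reduct_hom A A id.
Proof. by []. Qed.

Lemma is_reduct_hom_comp (A B C : ibsl) (g : B -> C) (f : A -> B) :
  is_reduct_hom g -> is_reduct_hom f -> is_reduct_hom (g \o f).
Proof.
move=> [gM gD gI] [fM fD fI].
by split=> *; rewrite /= ?(fM, fD, fI) ?(gM, gD, gI).
Qed.

Lemma is_ibsl_hom_id (A : ibsl) : @is_ibsl_hom A A id.
Proof. by []. Qed.

Lemma is_ibsl_hom_comp (A B C : ibsl) (g : B -> C) (f : A -> B) :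
  is_ibsl_hom g -> is_ibsl_hom f -> is_ibsl_hom (g \o f).
Proof.
move=> [gr g0 g1] [fr f0 f1].
by split; rewrite /= ?(f0, f1) //; exact: is_reduct_hom_comp.
Qed.

Definition IBSL : category :=
  concrete_category is_ibsl_hom_id is_ibsl_hom_comp.

(* Same objects as [IBSL], but arrows need not fix the constants. These are the
   arrows dual to those of [IGR]: if S is the two-element semilattice, seen as
   an object with [ib_zero = ib_one], there are two of them from the one-element
   algebra to S, and correspondingly two arrows of [IGR] from the dual of S to
   the space 3, which is initial in [IGR]; but only one fixes the constants.
   So [IGR] is not dually equivalent to [IBSL]. *)
Definition IBSL_reduct : category :=
  concrete_category is_reduct_hom_id is_reduct_hom_comp.

(** * GR spaces *)

Section Bands.
Variables (A : Type) (star : A -> A -> A) (le : A -> A -> Prop).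

Record left_normal_band : Prop := LeftNormalBand {
  starA : forall x y z, star x (star y z) = star (star x y) z;
  starxx : forall x, star x x = x;
  star_lnormal : forall x y z, star x (star y z) = star x (star z y) }.

Record po_left_normal_band : Prop := PoLeftNormalBand {
  po_band : left_normal_band;
  po_refl : forall x, le x x;
  po_anti : forall x y, le x y -> le y x -> x = y;
  po_trans : forall x y z, le x y -> le y z -> le x z;
  star_monol : forall x y z, le x y -> le (star x z) (star y z);
  star_monor : forall x y z, le x y -> le (star z x) (star z y);
  star_lel : forall x y, le (star x y) x }.

Definition sqle (a b : A) : Prop := le (star a b) b /\ star b a = b.

Record band_constants (c0 c1 ca : A) : Prop := BandConstants {
  star_xa : forall x, star x ca = ca;
  star_ax : forall x, star ca x = ca;
  star_x0 : forall x, star x c0 = x;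
  star_x1 : forall x, star x c1 = x;
  c0_sqle : forall x, sqle c0 x;
  le_c1 : forall x, le x c1;
  ca_le : forall x, le ca x;
  sqle_ca : forall x, sqle x ca;
  c01_neq : forall x, star c0 x = star c1 x -> x = ca }.
End Bands.

Record totally_order_disconnected (A : topologicalType) (le : A -> A -> Prop)
    : Prop := TotallyOrderDisconnected {
  tod_closed : closed [set p : A * A | le p.1 p.2];
  tod_sep : forall a b, ~ le a b ->
    exists U : set A, [/\ clopen U, (forall x y, le x y -> U y -> U x),
                          U b & ~ U a] }.

Record gr_space := GRSpace {
  gr_car :> topologicalType;
  gr_star : gr_car -> gr_car -> gr_car;
  gr_le : gr_car -> gr_car -> Prop;
  gr_c0 : gr_car;
  gr_c1 : gr_car;
  gr_ca : gr_car;
  gr_band : po_left_normal_band gr_star gr_le;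
  gr_cst : band_constants gr_star gr_le gr_c0 gr_c1 gr_ca;
  gr_cont : continuous (fun p : gr_car * gr_car => gr_star p.1 p.2);
  gr_compact : compact [set: gr_car];
  gr_tod : totally_order_disconnected gr_le }.

Definition gr_sqle (A : gr_space) : A -> A -> Prop :=
  sqle (@gr_star A) (@gr_le A).

Record is_gr_hom (A B : gr_space) (f : A -> B) : Prop := IsGRHom {
  grhom_cont : continuous f;
  grhom_star : forall x y, f (gr_star x y) = gr_star (f x) (f y);
  grhom_c0 : f (gr_c0 A) = gr_c0 B;
  grhom_c1 : f (gr_c1 A) = gr_c1 B;
  grhom_ca : f (gr_ca A) = gr_ca B;
  grhom_le : forall x y, gr_le x y -> gr_le (f x) (f y) }.

(** * The algebra and GR space 3 *)

Inductive three := T0 | T1 | Ta.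

Definition mul3 (x y : three) : three :=
  match x, y with
  | Ta, _ | _, Ta => Ta
  | T1, T1 => T1
  | _, _ => T0
  end.

Definition add3 (x y : three) : three :=
  match x, y with
  | Ta, _ | _, Ta => Ta
  | T0, T0 => T0
  | _, _ => T1
  end.

Definition inv3 (x : three) : three :=
  match x with T0 => T1 | T1 => T0 | Ta => Ta end.

Definition le3 (x y : three) : Prop := mul3 x y = x.

Definition star3 (a b : three) : three := if b is Ta then Ta else a.

HB.instance Definition _ := gen_eqMixin three.
HB.instance Definition _ := gen_choiceMixin three.
HB.instance Definition _ := hasNbhs.Build three principal_filter.
HB.instance Definition _ := Discrete_ofNbhs.Build three erefl.

Lemma po_band3 : po_left_normal_band star3 le3.
Proof.
split; rewrite /le3.
- by split; do ?case.
- by case.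
- by do 2 case.
- by do 3 case.
- by do 3 case.
- by do 3 case.
- by do 2 case.
Qed.

Lemma cst3 : band_constants star3 le3 T0 T1 Ta.
Proof. by split; rewrite /sqle /le3; case. Qed.

Lemma cont3 : continuous (fun p : three * three => star3 p.1 p.2).
Proof.
move=> p B /nbhs_singleton Bp.
exists ([set p.1], [set p.2]); last by case=> x y [/= -> ->].
by split; rewrite nbhs_principalE; apply/principal_filterP.
Qed.

Lemma compact3 : compact [set: three].
Proof.
have -> : [set: three] = [set T0] `|` [set T1] `|` [set Ta].
  by rewrite eqEsubset; split=> // -[] _; [left; left|left; right|right].
by do 2?[apply: compactU]; exact: compact_set1.
Qed.

Lemma tod3 : totally_order_disconnected le3.
Proof.
split; last first.
  move=> a b ab; exists [set x | le3 x b]; split=> //.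
  - by split; [exact: discrete_open|exact: discrete_closed].
  - by move=> x y; exact: (po_trans po_band3).
  - exact: (po_refl po_band3).
rewrite -[X in closed X]setCK; apply: open_closedC; rewrite openE => p np.
exists ([set p.1], [set p.2]); last by case: p np => ? ? np [x y] [/= -> ->].
by split; rewrite nbhs_principalE; apply/principal_filterP.
Qed.

Definition GR3 : gr_space := GRSpace po_band3 cst3 cont3 compact3 tod3.

Definition grHom3 (A : gr_space) := {f : A -> GR3 | is_gr_hom f}.

Definition hom3_fun (A : gr_space) (f : grHom3 A) : A -> three := sval f.
Coercion hom3_fun : grHom3 >-> Funclass.

(** * GR spaces with involution *)

(* [p0] is neutral for the pointwise addition, i.e. it is the element called
   phi_0 in (G6); such an element is unique. *)
Definition hom3_zero (A : gr_space) (p0 : grHom3 A) : Prop :=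
  forall (p : grHom3 A) (a : A), add3 (p a) (p0 a) = p a.

Record igr := IGRSpace {
  igr_space :> gr_space;
  igr_neg : igr_space -> igr_space;
  igr_neg_cont : continuous igr_neg;
  igr_G1 : forall a, igr_neg (igr_neg a) = a;
  igr_G2 : forall a b,
    igr_neg (gr_star a b) = gr_star (igr_neg a) (igr_neg b);
  igr_G3 : forall a b, gr_le a b -> gr_sqle (igr_neg b) (igr_neg a);
  igr_G4 : [/\ igr_neg (gr_c0 igr_space) = gr_c1 igr_space,
               igr_neg (gr_c1 igr_space) = gr_c0 igr_space
             & igr_neg (gr_ca igr_space) = gr_ca igr_space];
  igr_G5 : forall (p q : grHom3 igr_space) (a : igr_space),
    mul3 (p a) (add3 (inv3 (p (igr_neg a))) (q a)) = mul3 (q a) (p a);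
  igr_G6 : exists p0 p1 : grHom3 igr_space,
    (forall a, inv3 (p0 (igr_neg a)) = p1 a) /\ hom3_zero p0 }.

Record is_igr_hom (A B : igr) (f : A -> B) : Prop := IsIGRHom {
  igrhom_gr : is_gr_hom f;
  igrhom_neg : forall a, f (igr_neg a) = igr_neg (f a) }.

Lemma is_gr_hom_id (A : gr_space) : @is_gr_hom A A id.
Proof. by split=> // x; exact: cvg_id. Qed.

Lemma is_gr_hom_comp (A B C : gr_space) (g : B -> C) (f : A -> B) :
  is_gr_hom g -> is_gr_hom f -> is_gr_hom (g \o f).
Proof.
move=> [gc gs g0 g1 ga gl] [fc fs f0 f1 fa fl].
split=> [x|x y||||x y /fl /gl//]; rewrite /= ?fs ?gs ?f0 ?f1 ?fa //.
by apply: continuous_comp; [exact: fc|exact: gc].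
Qed.

Lemma is_igr_hom_id (A : igr) : @is_igr_hom A A id.
Proof. by split=> //; exact: is_gr_hom_id. Qed.

Lemma is_igr_hom_comp (A B C : igr) (g : B -> C) (f : A -> B) :
  is_igr_hom g -> is_igr_hom f -> is_igr_hom (g \o f).
Proof.
move=> [gg gn] [fg fn]; split; first exact: is_gr_hom_comp.
by move=> a; rewrite /= fn gn.
Qed.

Definition IGR : category := concrete_category is_igr_hom_id is_igr_hom_comp.

(* Arrows of [IGR] along which phi_0 pulls back to phi_0 (hence phi_1 to phi_1):
   the ones dual to the homomorphisms that fix the constants. *)
Record is_igr_hom0 (A B : igr) (f : A -> B) : Prop := IsIGRHom0 {
  igrhom0_hom : is_igr_hom f;
  igrhom0_zero : forall (p0 : grHom3 A) (q0 : grHom3 B),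
    hom3_zero p0 -> hom3_zero q0 -> forall a, q0 (f a) = p0 a }.

Lemma hom3_zero_unique (A : gr_space) (p q : grHom3 A) :
  hom3_zero p -> hom3_zero q -> forall a, p a = q a.
Proof.
move=> p0 q0 a; move: (p0 q a) (q0 p a).
by case: (p a); case: (q a).
Qed.

Lemma is_igr_hom0_id (A : igr) : @is_igr_hom0 A A id.
Proof.
split; first exact: is_igr_hom_id.
by move=> p0 q0 zp zq a; rewrite (hom3_zero_unique zq zp).
Qed.

Lemma is_igr_hom0_comp (A B C : igr) (g : B -> C) (f : A -> B) :
  is_igr_hom0 g -> is_igr_hom0 f -> is_igr_hom0 (g \o f).
Proof.
move=> [gh gz] [fh fz]; split; first exact: is_igr_hom_comp.
move=> p0 r0 zp zr a /=; have [q0 [q1 [_ zq]]] := igr_G6 B.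
by rewrite (gz _ _ zq zr) (fz _ _ zp zq).
Qed.

Definition IGR0 : category := concrete_category is_igr_hom0_id is_igr_hom0_comp.

(* Main.v *)
From HB Require Import structures.
From mathcomp Require Import all_boot all_order all_classical.
From mathcomp Require Import topology_structure product_topology compact.
From mathcomp Require Import discrete_topology separation_axioms.
From mathcomp Require Import subspace_topology.
Require Import Defs.

(** The dual of an involutive bisemilattice [B] is the space [bdual B] of the
    maps to 3 that preserve the product and the sum, and the dual of a space is
    its algebra of morphisms to 3; the units are the evaluation maps.

    On the algebraic side, [B] is a Plonka sum of Boolean algebras over a
    semilattice. Two points in different summands are separated by the indicator
    of the summands below one of them, two points of the same summand by an
    ultrafilter of it. A morphism [p] from [bdual B] to 3 is an evaluation: by
    compactness the clopen filter where [p] is not [Ta] is given by one element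
    of [B], and Priestley's double compactness argument then yields the value.

    On the spatial side, if [a] is not below [b], a clopen upper set separating
    them can be saturated to a clopen filter [W] (Numakura's argument). [W] has
    a least class, and composing the retraction of [W] onto this class with a
    clopen upper set gives a morphism to 3 separating [a] and [b]. Every map
    from the dual algebra to 3 is an evaluation by compactness again. *)

Set Implicit Arguments.
Unset Strict Implicit.
Unset Printing Implicit Defensive.

Local Open Scope classical_set_scope.

(** * Involutive bisemilattices *)

(** Only the binary operations are respected, not the involution: the constant maps at [T0] and [T1]
    must be points of the dual, where they become the constants c_0 and c_1. *)
Record is_bhom (B : ibsl) (h : B -> three) : Prop := IsBhom {
  bhom_mul : forall x y, h (ib_mul x y) = mul3 (h x) (h y);
  bhom_add : forall x y, h (ib_add x y) = add3 (h x) (h y) }.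

Section IbslTheory.
Variable B : ibsl.
Implicit Types x y z u v w : B.

Declare Scope ibsl_scope.
Local Open Scope ibsl_scope.
Local Notation "x + y" := (ib_add x y) : ibsl_scope.
Local Notation "x * y" := (ib_mul x y) : ibsl_scope.
Local Notation "- x" := (ib_inv x) : ibsl_scope.

Lemma ib_invD x y : - (x + y) = - x * - y.
Proof. by rewrite ib_mulE !ib_invK. Qed.

Lemma ib_invM x y : - (x * y) = - x + - y.
Proof. by rewrite ib_mulE ib_invK. Qed.

Lemma ib_mulC x y : x * y = y * x.
Proof. by rewrite !ib_mulE ib_addC. Qed.

Lemma ib_mulA x y z : x * (y * z) = x * y * z.
Proof. by rewrite !ib_mulE !ib_invK ib_addA. Qed.

Lemma ib_mulxx x : x * x = x.
Proof. by rewrite ib_mulE ib_addxx ib_invK. Qed.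

Lemma ib_mulACA x y z w : x * y * (z * w) = x * z * (y * w).
Proof. by rewrite -!ib_mulA (ib_mulA y) (ib_mulC y) -ib_mulA. Qed.

Lemma ib_addACA x y z w : x + y + (z + w) = x + z + (y + w).
Proof. by rewrite -!ib_addA (ib_addA y) (ib_addC y) -ib_addA. Qed.

Lemma ib_mulN_add x y : - x * (x + y) = - x * y.
Proof. by rewrite -{2}(ib_invK x) ib_mul_inv_add. Qed.

Lemma ib_add_inv_mul x y : x + - x * y = x + y.
Proof.
by apply: (can_inj (@ib_invK B)); rewrite !ib_invD ib_invM ib_mul_inv_add.
Qed.

(* In the Plonka sum of Boolean algebras given by [B], [lzero x] is the bottom
   of the summand containing [x]. *)
Definition lzero x := x * - x.

Lemma lzeroN x : lzero (- x) = lzero x.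
Proof. by rewrite /lzero ib_invK ib_mulC. Qed.

Lemma inv_lzero x : - lzero x = - x + x.
Proof. by rewrite /lzero ib_invM ib_invK. Qed.

Lemma mul_inv_lzero x : x * - lzero x = x.
Proof. by rewrite inv_lzero ib_mul_inv_add ib_mulxx. Qed.

Lemma mul_lzero x : x * lzero x = lzero x.
Proof. by rewrite /lzero ib_mulA ib_mulxx. Qed.

Lemma lzero_idem x : lzero (lzero x) = lzero x.
Proof.
rewrite {1}/lzero inv_lzero /lzero (ib_mulC x) -ib_mulA ib_mul_inv_add.
by rewrite ib_mulxx.
Qed.

(** Absorption expands [lzero x * z] into a product of [lzero x] with all four sums of [x] or [- x]
    with [z] or [- z], an expression that is symmetric in [z] and [- z]. *)
Lemma lzero_mulN x y : lzero x * y = lzero x * - y.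
Proof.
have E z : lzero x * z =
    lzero x * ((- x + z) * (x + z)) * ((- z + x) * (- z + - x)).
  have E1 : lzero x * z = z * ((- z + x) * (- z + - x)).
    rewrite -{2}(ib_mulxx z) ib_mulACA !ib_mul_inv_add ib_mulACA ib_mulxx.
    exact: ib_mulC.
  have E2 : lzero x * z = lzero x * ((- x + z) * (x + z)).
    rewrite {2}/lzero ib_mulACA ib_mul_inv_add ib_mulN_add ib_mulACA ib_mulxx.
    by [].
  by rewrite -E2 -ib_mulA -E1 ib_mulA ib_mulxx.
rewrite (E y) (E (- y)) ib_invK -!(ib_mulA (lzero x)); congr (_ * _).
rewrite [RHS]ib_mulC; congr (_ * _); rewrite ib_mulC.
  by rewrite !(ib_addC y).
by rewrite !(ib_addC (- y)).
Qed.

Lemma lzero_mulr x y : lzero x * y = lzero x * lzero y.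
Proof.
by rewrite -(ib_mulxx (lzero x * y)) {2}lzero_mulN ib_mulACA ib_mulxx.
Qed.

Lemma lzeroDM x y : lzero (x + y) = lzero x * lzero y.
Proof.
rewrite {1}/lzero ib_invD ib_mulA (ib_mulC _ (- x)) ib_mulN_add -ib_mulA.
by rewrite -[y * - y]/(lzero y) ib_mulC lzero_mulr lzeroN ib_mulC.
Qed.

(** The bottoms form the index semilattice of the Plonka sum. With c = a + b one has c = c * (c + -
    c), where c + - c = a + - b = a + - a * - b = a + - c; absorption leaves c = c * a, which is a *
    b. *)
Lemma lzero_add x y : lzero x + lzero y = lzero x * lzero y.
Proof.
set a := lzero x; set b := lzero y; pose c := a + b.
have aE : - a + a = - a by rewrite -inv_lzero lzero_idem.
have bE : - b + b = - b by rewrite -inv_lzero lzero_idem.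
have cE : c + - c = a + - b.
  rewrite ib_invD /c -ib_addA (ib_addC b) ib_addA ib_add_inv_mul -ib_addA bE.
  by [].
have ca : a * c = a * b.
  by rewrite -ib_mul_inv_add /c ib_addA aE ib_mul_inv_add.
have cc : c * (- c + c) = c by rewrite ib_mul_inv_add ib_mulxx.
rewrite -/c -[LHS]cc (ib_addC (- c)) cE -ib_add_inv_mul -ib_invD ib_addC -/c.
by rewrite ib_mul_inv_add ib_mulC ca.
Qed.

Lemma lzeroD x y : lzero (x + y) = lzero x + lzero y.
Proof. by rewrite lzeroDM lzero_add. Qed.

Lemma lzeroM x y : lzero (x * y) = lzero x + lzero y.
Proof. by rewrite -lzeroN ib_invM lzeroD !lzeroN. Qed.

(** The Plonka order of the indices: the summand of [z] has a transition map into the summand of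
    [x]. *)
Definition below x z := lzero x + lzero z = lzero x.

Lemma below_refl x : below x x.
Proof. exact: ib_addxx. Qed.

Lemma below_split x u v : lzero x + (u + v) = lzero x <->
  lzero x + u = lzero x /\ lzero x + v = lzero x.
Proof.
split=> [E|[E1 E2]]; last by rewrite ib_addA E1.
split; rewrite -E -!ib_addA; congr (_ + _).
  by rewrite (ib_addC _ u) ib_addA ib_addxx.
by rewrite ib_addxx.
Qed.

Lemma belowD x z w : below x (z + w) <-> below x z /\ below x w.
Proof. by rewrite /below lzeroD; exact: below_split. Qed.

Lemma belowM x z w : below x (z * w) <-> below x z /\ below x w.
Proof. by rewrite /below lzeroM; exact: below_split. Qed.

Definition below_fun x (U : set B) z : three :=
  if `[< below x z >] then if `[< U z >] then T1 else T0 else Ta.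

(** A sum or product lies below [x] exactly when both arguments do, which settles the value [Ta];
    what remains is that [U] behaves like a prime filter on the elements below [x]. *)
Lemma below_fun_bhom x (U : set B) :
    (forall z w, below x z -> below x w -> U (z * w) <-> U z /\ U w) ->
    (forall z w, below x z -> below x w -> U (z + w) <-> U z \/ U w) ->
  is_bhom (below_fun x U).
Proof.
move=> UM UD; split=> z w; rewrite /below_fun.
  rewrite (asbool_equiv_eq (belowM x z w)) asbool_and.
  case: asboolP => bz; case: asboolP => bw /=; try by [|case: asboolP].
  by rewrite (asbool_equiv_eq (UM _ _ bz bw)) asbool_and; do 2 case: asboolP.
rewrite (asbool_equiv_eq (belowD x z w)) asbool_and.
case: asboolP => bz; case: asboolP => bw /=; try by [|case: asboolP].
by rewrite (asbool_equiv_eq (UD _ _ bz bw)) asbool_or; do 2 case: asboolP.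
Qed.

Lemma below_bhom x : is_bhom (below_fun x set0).
Proof. by apply: below_fun_bhom => z w _ _; split=> -[]. Qed.

(** * Ultrafilters of a single Boolean summand, with bottom [e] *)

Section Summand.
Variable e : B.
Hypothesis ee : lzero e = e.
Let C := [set z | lzero z = e].

Lemma summandM z w : C z -> C w -> C (z * w).
Proof. by rewrite /C /= lzeroM => -> ->; rewrite ib_addxx. Qed.

Lemma summandD z w : C z -> C w -> C (z + w).
Proof. by rewrite /C /= lzeroD => -> ->; rewrite ib_addxx. Qed.

Lemma summandN z : C z -> C (- z).
Proof. by rewrite /C /= lzeroN. Qed.

Lemma summand_mul_top z : C z -> z * - e = z.
Proof. by move=> <-; exact: mul_inv_lzero. Qed.

Lemma summand_mul_bot z : C z -> z * e = e.
Proof. by move=> <-; exact: mul_lzero. Qed.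

Lemma summand_absorb z w : C z -> C w -> z * (z + w) = z.
Proof.
move=> Cz Cw; rewrite -ib_mul_inv_add ib_addA -inv_lzero Cz.
have ew : e * - w = e by rewrite -Cw /lzero -ib_mulA ib_mulxx.
by rewrite -(ib_invK w) -ib_invM ew summand_mul_top.
Qed.

Lemma summand_disjoint z w : C z -> z * w = e -> z * - w = z.
Proof.
by move=> Cz E; rewrite -ib_mul_inv_add -ib_invM E summand_mul_top.
Qed.

Definition summand_filter (U : set B) : Prop :=
  [/\ U `<=` C, ~ U e, (forall z w, U z -> U w -> U (z * w))
    & forall z w, U z -> C w -> z * w = z -> U w].

Lemma summand_ultrafilter m : C m -> m <> e ->
  exists U, [/\ summand_filter U, U m & forall z, C z -> ~ U z -> U (- z)].
Proof.
move=> Cm me.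
pose Q (U : set B) := U = set0 \/ summand_filter U /\ U m.
have [F FQ Ftot|U [QU Umax]] := @Zorn_bigcup B Q.
  have [[X FX [z Xz]]|F0] := pselect (exists2 X, F X & X !=set0); last first.
    left; rewrite predeqE => z; split=> // -[X FX Xz].
    by apply: F0; exists X => //; exists z.
  have FQ' Y : F Y -> Y !=set0 -> summand_filter Y /\ Y m.
    by move=> /FQ[->[]|].
  right; split; last first.
    by exists X => //; apply: (FQ' _ FX _).2; exists z.
  split.
  - by move=> w [Y FY Yw]; have [[YC _ _ _] _] := FQ' Y FY (ex_intro _ w Yw);
       exact: YC.
  - by move=> [Y FY Ye]; have [[_ + _ _] _] := FQ' Y FY (ex_intro _ e Ye).
  - move=> u v [Y FY Yu] [Z FZ Zv].
    have [[_ _ YM _] _] := FQ' Y FY (ex_intro _ u Yu).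
    have [[_ _ ZM _] _] := FQ' Z FZ (ex_intro _ v Zv).
    have [YZ|ZY] := Ftot _ _ FY FZ.
      by exists Z => //; apply: ZM => //; exact: YZ.
    by exists Y => //; apply: YM => //; exact: ZY.
  - move=> u v [Y FY Yu] Cv uv; exists Y => //.
    by have [[_ _ _ +] _] := FQ' Y FY (ex_intro _ u Yu); apply; eassumption.
have {QU} [[UC Ue UM Uup] Um] : summand_filter U /\ U m.
  case: QU => // U0; exfalso.
  (* The principal filter of [m] shows that the empty set is not maximal. *)
  apply: (Umax [set w | C w /\ m * w = m]).
    split; first by rewrite U0.
    by move=> /(_ m); rewrite U0; apply; split=> //; exact: ib_mulxx.
  right; split; last by split=> //; exact: ib_mulxx.
  split=> [w []//|[_]|z w [Cz mz] [Cw mw]|z w [_ mz] Cw zw].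
  - by rewrite summand_mul_bot // => /esym.
  - by split; [exact: summandM|rewrite ib_mulA mz].
  - by split=> //; rewrite -mz -ib_mulA zw.
exists U; split=> // z Cz Uz.
(* [V] is the filter generated by [U] and [z]. If it is improper, some [u] in [U] is disjoint from
   [z], hence below [- z]; otherwise it contradicts maximality. *)
pose V := [set w | C w /\ exists2 u, U u & u * z * w = u * z].
have [[_ [u Uu uze]]|Ve] := pselect (V e).
  apply: (Uup u) => //; first exact: summandN.
  apply: summand_disjoint; first exact: UC.
  rewrite -uze summand_mul_bot //.
  by apply: summandM => //; exact: UC.
exfalso; apply: (Umax V).
  split=> [w Uw|/(_ z) zU].
    split; first exact: UC.
    by exists w => //; rewrite ib_mulC ib_mulA ib_mulxx.
  apply/Uz/zU; split=> //; exists m => //.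
  by rewrite -ib_mulA ib_mulxx.
right; split; last first.
  split=> //; exists m => //; by rewrite ib_mulC ib_mulA ib_mulxx.
split=> // [w []//|v w [Cv [u1 U1 E1]] [Cw [u2 U2 E2]]|v w [Cv [u Uu E]] Cw vw].
  split; first exact: summandM.
  exists (u1 * u2); first exact: UM.
  have -> : u1 * u2 * z = (u1 * z) * (u2 * z).
    by rewrite ib_mulACA ib_mulxx.
  by rewrite ib_mulACA E1 E2.
by split=> //; exists u => //; rewrite -E -ib_mulA vw.
Qed.

(** Adding [e] is the transition map into the summand of [e]. The first form shows that it respects
    sums, the second that it respects products. *)
Lemma summand_translate z : below e z -> C (z + e) /\ z + e = - e * z.
Proof.
rewrite /below ee => bz.
have Cze : C (z + e) by rewrite /C /= lzeroD ee ib_addC.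
split=> //; rewrite -[LHS]summand_mul_top // ib_mulC (ib_addC z).
exact: ib_mulN_add.
Qed.

End Summand.

Lemma bhom_separation x y : x <> y -> exists2 h, is_bhom h & h x <> h y.
Proof.
move=> xy.
have [bxy|nbxy] := pselect (below x y); last first.
  exists (below_fun x set0); first exact: below_bhom.
  rewrite /below_fun; case: asboolP => // [_|[]]; last exact: below_refl.
  by case: asboolP => // _; case: asboolP.
have [byx|nbyx] := pselect (below y x); last first.
  exists (below_fun y set0); first exact: below_bhom.
  rewrite /below_fun [in X in _ <> X]asboolT; last exact: below_refl.
  by rewrite asboolF //; case: ifP.
have lxy : lzero y = lzero x by rewrite -bxy ib_addC byx.
pose e := lzero x.
have ee : lzero e = e by exact: lzero_idem.
(* Within one summand, if both [x * - y] and [y * - x] were the bottom, then [x = x * y = y]; so up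
   to exchanging [x] and [y] the first is not the bottom. *)
wlog me : x y xy bxy byx lxy @e ee / x * - y <> e.
  move=> H; have [xye|] := pselect (x * - y = e); last exact: (H x y).
  have [yxe|yx] := pselect (y * - x = e).
    exfalso; apply: xy.
    have := summand_disjoint erefl xye; rewrite ib_invK => <-.
    by have := summand_disjoint lxy yxe; rewrite ib_invK ib_mulC.
  have yx' : y <> x by move=> /esym.
  have := H y x yx' byx bxy (esym lxy); rewrite lxy => /(_ ee yx)[h hh hyx].
  by exists h => // /esym.
have Cx : lzero x = e by [].
have Cm : lzero (x * - y) = e by apply: summandM => //; exact: summandN.
have [U [[UC Ue UM Uup] Um Uult]] := summand_ultrafilter Cm me.
(* The ultrafilter contains [x] and [- y]; it is pulled back along the transition maps to all
   summands below [e]. *)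
pose V := [set z | U (z + e)].
exists (below_fun e V); last first.
  have Ux : U (x + e).
    have [|Cxe xe] := @summand_translate e ee x.
      by rewrite /below ee; exact: ib_addxx.
    apply: (Uup _ _ Um) => //.
    by rewrite xe (ib_mulC (- e)) mul_inv_lzero ib_mulC ib_mulA ib_mulxx.
  have Uy : ~ U (y + e).
    have [|Cye ye] := @summand_translate e ee y.
      by rewrite /below ee lxy; exact: ib_addxx.
    rewrite ye ib_mulC /e -lxy mul_inv_lzero => Uy; apply: Ue.
    rewrite /e -lxy; apply: UM => //.
    apply: (Uup _ _ Um); first exact: summandN.
    by rewrite -ib_mulA ib_mulxx.
  rewrite /below_fun asboolT; last by rewrite /below ee ib_addxx.
  rewrite asboolT // asboolT; last by rewrite /below ee lxy ib_addxx.
  by rewrite asboolF.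
apply: below_fun_bhom => z w bz bw;
  have [Cz zE] := summand_translate ee bz;
  have [Cw wE] := summand_translate ee bw.
  rewrite /V /= (_ : z * w + e = (z + e) * (w + e)); last first.
    rewrite zE wE ib_mulACA ib_mulxx; apply: (summand_translate ee _).2.
    exact/belowM.
  split=> [Uzw|[Uz Uw]]; last exact: UM.
  split; apply: (Uup _ _ Uzw) => //.
    by rewrite ib_mulC ib_mulA ib_mulxx.
  by rewrite -ib_mulA ib_mulxx.
rewrite /V /= (_ : z + w + e = (z + e) + (w + e)); last first.
  by rewrite ib_addACA ib_addxx.
split=> [Uzw|].
  (* If neither summand were in [U], both complements would be, and then so would the product of the
     sum with its own complement, which is [e]. *)
  apply: contrapT => /not_orP[nz nw]; apply: Ue.
  have : U ((z + e + (w + e)) * (- (z + e) * - (w + e))).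
    by apply: (UM) => //; apply: UM; exact: Uult.
  by rewrite -ib_invD -/(lzero _) (summandD Cz Cw).
have Czw := summandD Cz Cw.
move=> [Uz|Uw]; [apply: (Uup _ _ Uz)|apply: (Uup _ _ Uw)] => //.
  exact: summand_absorb Cz Cw.
by rewrite (ib_addC (z + e)); exact: summand_absorb Cw Cz.
Qed.

End IbslTheory.

(** * The dual space *)

Lemma clopen_near (T : topologicalType) (V : set T) (x : T) :
  clopen V -> nbhs x [set y | V y <-> V x].
Proof.
move=> [oV cV]; have [Vx|nVx] := pselect (V x).
  by apply: filterS (open_nbhs_nbhs (conj oV Vx)) => y.
by apply: filterS (open_nbhs_nbhs (conj (closed_openC cV) nVx)) => y.
Qed.

Lemma near_clopen (T : topologicalType) (V : set T) :
  (forall x, nbhs x [set y | V y <-> V x]) -> clopen V.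
Proof.
move=> nV; split.
  by rewrite openE => x Vx; apply: filterS (nV x) => y [_]; exact.
rewrite -[V]setCK; apply: open_closedC; rewrite openE => x Vx.
by apply: filterS (nV x) => y [Vxy _] /Vxy.
Qed.

Lemma continuous3P (T : topologicalType) (f : T -> three) :
  continuous f <-> forall x, nbhs x [set y | f y = f x].
Proof.
split=> cf x; first exact: (cf x [set f x]) (discrete_set1 (f x)).
by move=> A /nbhs_singleton Afx; apply: filterS (cf x) => y /= ->.
Qed.

Lemma continuous3_clopen (T : topologicalType) (f : T -> three)
  (P : set three) : continuous f -> clopen [set x | P (f x)].
Proof.
move=> cf; apply: (@preimage_clopen _ _ f) => //.
by split; [exact: discrete_open|exact: discrete_closed].
Qed.

(** The sets form a filter base, and a cluster point of its filter lies in every closed member.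
    Indexing by [I] lets families of algebra elements, directed under an operation, be used
    directly. *)
Lemma compact_directed (T : topologicalType) (I : Type) (D : set I)
    (C : I -> set T) :
    compact [set: T] -> D !=set0 ->
    (forall i, D i -> closed (C i)) -> (forall i, D i -> C i !=set0) ->
    (forall i j, D i -> D j -> exists2 k, D k & C k `<=` C i `&` C j) ->
  exists x, forall i, D i -> C i x.
Proof.
move=> cT D0 clC C0 Cdir.
have FF : Filter (filter_from D C) by exact: filter_from_filter.
have PF : ProperFilter (filter_from D C) by exact: filter_from_proper.
have [x [_ clx]] := cT _ PF filterT.
exists x => i Di; apply: (clC i Di) => A nA.
by apply: clx => //; exists i.
Qed.

Definition bdual (B : ibsl) := {h : B -> three | is_bhom h}.

Definition bdual_fun (B : ibsl) (h : bdual B) : B -> three := sval h.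
Coercion bdual_fun : bdual >-> Funclass.

Lemma bdual_eq (B : ibsl) (h k : bdual B) : (forall b, h b = k b) -> h = k.
Proof.
case: h k => h Ph [k Pk] /= /funext hk; case: _ / hk Pk => Pk.
by rewrite (Prop_irrelevance Ph Pk).
Qed.

Section BdualTopology.
Variable B : ibsl.

(* Topology of pointwise convergence. *)
Definition bdual_nbhs (h : bdual B) : set_system (bdual B) :=
  [set A | exists s : seq B, [set k : bdual B | map k s = map h s] `<=` A].

HB.instance Definition _ := gen_eqMixin (bdual B).
HB.instance Definition _ := gen_choiceMixin (bdual B).
HB.instance Definition _ := hasNbhs.Build (bdual B) bdual_nbhs.

Lemma bdual_nbhs_singleton (h : bdual B) (A : set (bdual B)) :
  nbhs h A -> A h.
Proof. by case=> s; exact. Qed.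

Lemma bdual_nbhs_filter (h : bdual B) : ProperFilter (nbhs h).
Proof.
apply: Build_ProperFilter_ex => [A /bdual_nbhs_singleton|]; first by exists h.
split=> [|A1 A2 [s sA] [t tA]|A1 A2 sA [s s1]].
- by exists [::].
- exists (s ++ t) => k /=; rewrite !map_cat => /eqP.
  by rewrite eqseq_cat ?size_map// => /andP[/eqP ks /eqP kt]; split;
    [exact: sA|exact: tA].
- by exists s; exact: subset_trans s1 sA.
Qed.

Lemma bdual_nbhs_nbhs (h : bdual B) (A : set (bdual B)) :
  nbhs h A -> nbhs h (nbhs^~ A).
Proof.
by case=> s sA; exists s => k /= ks; exists s => l /=; rewrite ks; exact: sA.
Qed.

HB.instance Definition _ := Nbhs_isNbhsTopological.Build (bdual B)
  bdual_nbhs_filter bdual_nbhs_singleton bdual_nbhs_nbhs.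

Lemma bdual_eval_continuous (b : B) : continuous (fun h : bdual B => h b).
Proof. by apply/continuous3P => h; exists [:: b] => k /= []. Qed.

Lemma continuous_to_bdual (T : topologicalType) (f : T -> bdual B) :
  (forall b, continuous (fun x => f x b)) -> continuous f.
Proof.
move=> cf x A [s sA]; apply: filterS sA _.
elim: s => [|b s IHs]; first exact: filterE.
have /continuous3P/(_ x) nb := cf b.
by apply: filterS2 nb IHs => y /= -> ->.
Qed.

(** An ultrafilter decides the value at each element of [B]. The map of these values is again a
    point of the dual, because each instance of preservation involves three values only and some
    member of the ultrafilter realises all three. *)
Lemma bdual_compact : compact [set: bdual B].
Proof.
rewrite compact_ultra => F FU _.
have FP := @ultra_proper _ _ FU.
have lim b : exists v, F [set k : bdual B | k b = v].
  have [|F0] := in_ultra_setVsetC [set k : bdual B | k b = T0] FU.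
    by exists T0.
  have [|F1] := in_ultra_setVsetC [set k : bdual B | k b = T1] FU.
    by exists T1.
  by exists Ta; apply: filterS2 F0 F1 => k /=; case: (k b).
pose h b := sval (cid (lim b)).
have hE b : F [set k : bdual B | k b = h b] by rewrite /h; case: cid.
have hh : is_bhom h.
  split=> x y.
    have [k [<- [<- <-]]] := filter_ex
      (filterI (hE (ib_mul x y)) (filterI (hE x) (hE y))).
    exact: (bhom_mul (proj2_sig k)).
  have [k [<- [<- <-]]] := filter_ex
    (filterI (hE (ib_add x y)) (filterI (hE x) (hE y))).
  exact: (bhom_add (proj2_sig k)).
exists (exist _ h hh); split=> // A [s sA]; apply: filterS sA _.
elim: s => [|b s IHs]; first exact: filterE.
by apply: filterS2 (hE b) IHs => k /= -> ->.
Qed.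

End BdualTopology.

Lemma const_bhom (B : ibsl) (v : three) : is_bhom (fun _ : B => v).
Proof. by split=> _ _; case: v. Qed.

Lemma star_bhom (B : ibsl) (h k : bdual B) :
  is_bhom (fun b => star3 (h b) (k b)).
Proof.
case: h k => h [hM hD] [k [kM kD]]; split=> x y /=.
  by rewrite hM kM; case: (h x) (h y) (k x) (k y); do 3 case.
by rewrite hD kD; case: (h x) (h y) (k x) (k y); do 3 case.
Qed.

Lemma neg_bhom (B : ibsl) (h : bdual B) :
  is_bhom (fun b => inv3 (h (ib_inv b))).
Proof.
case: h => h [hM hD]; split=> x y /=.
  by rewrite ib_invM hD; case: (h _) (h _); do 1 case.
by rewrite ib_invD hM; case: (h _) (h _); do 1 case.
Qed.

(** * The pointwise GR structure on the dual *)

Section BdualGR.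
Variable B : ibsl.
Implicit Types h k : bdual B.

Definition bdual_star h k : bdual B := exist _ _ (star_bhom h k).
Definition bdual_le h k : Prop := forall b, le3 (h b) (k b).
Definition bdual_const v : bdual B := exist _ _ (const_bhom B v).

Lemma bdual_band : po_left_normal_band bdual_star bdual_le.
Proof.
have P3 := po_band3; split.
- have [sA sxx sln] := po_band P3.
  by split=> *; apply: bdual_eq => b; [exact: sA|exact: sxx|exact: sln].
- by move=> h b; exact: (po_refl P3).
- by move=> h k hk kh; apply: bdual_eq => b; exact: (po_anti P3).
- by move=> h k l hk kl b; exact: (po_trans P3) (hk b) (kl b).
- by move=> h k l hk b; exact: (star_monol P3) (hk b).
- by move=> h k l hk b; exact: (star_monor P3) (hk b).
- by move=> h k b; exact: (star_lel P3).
Qed.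

Lemma bdual_cst : band_constants bdual_star bdual_le
  (bdual_const T0) (bdual_const T1) (bdual_const Ta).
Proof.
have P3 := cst3; split.
- by move=> h; apply: bdual_eq => b; exact: (star_xa P3).
- by move=> h; apply: bdual_eq => b; exact: (star_ax P3).
- by move=> h; apply: bdual_eq => b; exact: (star_x0 P3).
- by move=> h; apply: bdual_eq => b; exact: (star_x1 P3).
- move=> h; split=> [b|]; first exact: (c0_sqle P3 (h b)).1.
  by apply: bdual_eq => b; exact: (c0_sqle P3 (h b)).2.
- by move=> h b; exact: (le_c1 P3).
- by move=> h b; exact: (ca_le P3).
- move=> h; split=> [b|]; first exact: (sqle_ca P3 (h b)).1.
  by apply: bdual_eq => b; exact: (sqle_ca P3 (h b)).2.
- move=> h E; apply: bdual_eq => b; apply: (c01_neq P3).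
  by have := congr1 (fun k : bdual B => k b) E.
Qed.

Lemma bdual_star_continuous :
  continuous (fun p : bdual B * bdual B => bdual_star p.1 p.2).
Proof.
apply: continuous_to_bdual => b; apply/continuous3P => -[h k].
have /continuous3P/(_ h) nh := @bdual_eval_continuous B b.
have /continuous3P/(_ k) nk := @bdual_eval_continuous B b.
exists ([set y | bdual_fun y b = bdual_fun h b],
    [set y | bdual_fun y b = bdual_fun k b]) => //.
by move=> [x y] [/= xb yb]; rewrite /bdual_star /= xb yb.
Qed.

Lemma bdual_tod : totally_order_disconnected bdual_le.
Proof.
split.
  rewrite (_ : [set p | _] = \bigcap_(b in [set: B])
    [set p : bdual B * bdual B | le3 (p.1 b) (p.2 b)]); last first.
    by rewrite predeqE => p; split=> [le b _|le b]; exact: le.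
  apply: closed_bigI => b _; apply: (near_clopen _).2 => -[h k].
  have /continuous3P/(_ h) nh := @bdual_eval_continuous B b.
  have /continuous3P/(_ k) nk := @bdual_eval_continuous B b.
  exists ([set y | bdual_fun y b = bdual_fun h b],
    [set y | bdual_fun y b = bdual_fun k b]) => //.
  by move=> [x y] [/= -> ->].
move=> h k /existsNP[b hk].
exists [set x : bdual B | le3 (x b) (bdual_fun k b)]; split=> //.
- apply: (continuous3_clopen [set v | le3 v (bdual_fun k b)]).
  exact: bdual_eval_continuous.
- by move=> x y xy; exact: (po_trans po_band3) (xy b).
- exact: (po_refl po_band3).
Qed.

Definition bdual_gr : gr_space := GRSpace bdual_band bdual_cst
  bdual_star_continuous (@bdual_compact B) bdual_tod.

Definition bdual_neg h : bdual B := exist _ _ (neg_bhom h).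

End BdualGR.

(** * Separation in GR spaces *)

Section GRTheory.
Variable A : gr_space.
Implicit Types (x y z a b e s : A) (V W : set A).

Declare Scope gr_scope.
Local Open Scope gr_scope.
Local Notation "x * y" := (gr_star x y) : gr_scope.
Local Notation "x <= y" := (gr_le x y) : gr_scope.
Local Notation c0 := (gr_c0 A).
Local Notation c1 := (gr_c1 A).
Local Notation ca := (gr_ca A).

Let grA x y z : x * (y * z) = x * y * z.
Proof. exact: (starA (po_band (gr_band A))). Qed.

Let grxx x : x * x = x.
Proof. exact: (starxx (po_band (gr_band A))). Qed.

Let grAC x y z : x * y * z = x * z * y.
Proof. by rewrite -!grA; exact: (star_lnormal (po_band (gr_band A))). Qed.

Let gr_trans y x z : x <= y -> y <= z -> x <= z.
Proof. exact: (po_trans (gr_band A)). Qed.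

Let gr_starl x y : x * y <= x.
Proof. exact: (star_lel (gr_band A)). Qed.

Let grx0 x : x * c0 = x.
Proof. exact: (star_x0 (gr_cst A)). Qed.

Let gr_c0l x : c0 * x <= x.
Proof. exact: (c0_sqle (gr_cst A) x).1. Qed.

Let gr_c1r x y : x * y <= c1 * y.
Proof. exact/(star_monol (gr_band A))/(le_c1 (gr_cst A)). Qed.

Lemma gr_le_star x y : x <= y -> x * y = x.
Proof.
move=> xy; apply: (po_anti (gr_band A)) => //.
by rewrite -{1}(grxx x); exact: (star_monor (gr_band A)).
Qed.

Lemma gr_starl_continuous y : continuous (fun x => x * y).
Proof.
move=> x; apply: (@continuous_comp _ _ _ (fun x => (x, y))
  (fun p : A * A => p.1 * p.2)); last exact: gr_cont.
by apply: cvg_pair; [exact: cvg_id|exact: cvg_cst].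
Qed.

(** Since [x * y <= x] always holds, the equation amounts to [x <= x * y], and the order is
    closed. *)
Lemma gr_star_fix_closed y : closed [set x | x * y = x].
Proof.
rewrite (_ : [set x | _] =
    (fun x => (x, x * y)) @^-1` [set p | p.1 <= p.2]); last first.
  rewrite predeqE => x; split=> /= [->|xy]; first exact: (po_refl (gr_band A)).
  exact: (po_anti (gr_band A)).
apply: preimage_closed; last exact: tod_closed (gr_tod A).
by move=> x _; apply: cvg_pair; [exact: cvg_id|exact: gr_starl_continuous].
Qed.

Definition upper V : Prop := forall x y, x <= y -> V x -> V y.

Lemma gr_clopen_upper a b : ~ a <= b ->
  exists V, [/\ clopen V, upper V, V a & ~ V b].
Proof.
move=> /(tod_sep (gr_tod A))[U [cU lU Ub Ua]].
exists (~` U); split=> //; first exact: (clopenC set0).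
by move=> x y xy Ux Uy; apply/Ux/lU/Uy.
Qed.

(** Preimages of filters of the semilattice quotient of the band: the possible supports, that is
    sets where the value is not [Ta], of morphisms into 3. *)
Record clopen_filter W : Prop := ClopenFilter {
  cfilter_clopen : clopen W;
  cfilter_star : forall x y, W (x * y) <-> W x /\ W y;
  cfilter_c0 : W c0 }.

(** Such an [e] represents the least class of [W]. Another choice e' gives the same retraction, as x
    * e = x * (e * e') = x * (e' * e) = x * e'. *)
Definition least_in W e : Prop := W e /\ forall y, W y -> e * y = e.

(** For [y] in [W], the elements of [W] fixed by right multiplication by [y] form a closed set
    containing [y], and the set for [y * z] lies in those for [y] and for [z]. *)
Lemma clopen_filter_least W : clopen_filter W -> exists e, least_in W e.
Proof.
move=> [[_ clW] Ws W0].
have [|y _|y Wy|y z Wy Wz|e He] := @compact_directed A A W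
  (fun y => W `&` [set x | x * y = x]) (@gr_compact A).
- by exists c0.
- by apply: closedI => //; exact: gr_star_fix_closed.
- by exists y; split.
- exists (y * z); first exact/Ws.
  move=> x [Wx /= xyz]; do !split=> //.
    by rewrite /= -xyz grA [in LHS]grAC -[x * y * y]grA grxx.
  by rewrite /= -xyz grA -[x * y * z * z]grA grxx.
by exists e; split=> [|y Wy]; [exact: (He _ W0).1|exact: (He y Wy).2].
Qed.

Definition filter_fun W V e x : three :=
  if `[< W x >] then if `[< V (x * e) >] then T1 else T0 else Ta.

Lemma filter_fun_hom W V e : clopen_filter W -> least_in W e ->
    clopen V -> upper V -> ~ V (c0 * e) -> V (c1 * e) ->
  is_gr_hom (filter_fun W V e : A -> GR3).
Proof.
move=> [cW Ws W0] [We emin] cV upV V0 V1.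
have W1 : W c1 by have := W0; rewrite -(star_x1 (gr_cst A) c0) => /Ws[].
(* Otherwise [e] would be [ca], and [c0 * e] and [c1 * e] would coincide. *)
have Wa : ~ W ca.
  move=> /emin; rewrite (star_xa (gr_cst A)) => eE; apply: V0.
  by move: V1; rewrite -eE !(star_xa (gr_cst A)).
split.
- apply/continuous3P => x.
  have nV : nbhs x [set y | V (y * e) <-> V (x * e)].
    exact: (@gr_starl_continuous e x) (clopen_near (x * e) cV).
  apply: filterS2 (clopen_near x cW) nV => y /= Wyx Vyx.
  by rewrite /filter_fun (asbool_equiv_eq Wyx) (asbool_equiv_eq Vyx).
- move=> x y; rewrite -[RHS]/(star3 _ _) /filter_fun.
  rewrite (asbool_equiv_eq (Ws x y)) asbool_and.
  case: asboolP => Wx; case: asboolP => Wy //=; last by case: asboolP.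
  (* For [y] in [W] one has [x * y * e = x * (e * y) = x * e], so the product takes the value of its
     first factor. *)
  by rewrite grAC -grA emin //; case: asboolP => // _; case: asboolP.
- by rewrite /filter_fun asboolT // asboolF.
- by rewrite /filter_fun asboolT // asboolT.
- by rewrite /filter_fun asboolF.
- move=> x y xy; rewrite /filter_fun.
  case: asboolP => Wx; last exact: (ca_le cst3).
  have Wy : W y by move: Wx; rewrite -(gr_le_star xy) => /Ws[].
  rewrite [in X in gr_le _ X]asboolT //.
  case: asboolP => Vx; last by case: asboolP.
  by rewrite asboolT //; apply: upV Vx; exact: (star_monol (gr_band A)).
Qed.

(* The elements [x] with [a * x] congruent to [a] for the largest congruence of
   which [V] is a union of classes; clopen by compactness (Numakura). *)
Definition saturation V a : set A :=
  [set x | forall s, V (s * a * x) <-> V (s * a)].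

(** For each [s] the condition is constant near (s, x); by compactness one neighbourhood of [x]
    serves all [s] at once. *)
Lemma saturation_clopen V a : clopen V -> clopen (saturation V a).
Proof.
move=> cV; apply: near_clopen => x.
have cS : continuous (fun p : A * A => p.1 * a * p.2).
  move=> p; apply: (@continuous_comp _ _ _ (fun p : A * A => (p.1 * a, p.2))
    (fun q : A * A => q.1 * q.2)); last exact: gr_cont.
  apply: cvg_pair; last exact: cvg_snd.
  apply: (@continuous_comp _ _ _ fst (fun s : A => s * a)).
    exact: cvg_fst.
  exact: gr_starl_continuous.
have cV' : clopen [set p : A * A | V (p.1 * a * p.2)].
  exact: (preimage_clopen cV cS).
have /compact_near_coveringP cA := @gr_compact A.
have nx : forall s, [set: A] s -> \forall s' \near s & y \near x,
    V (s' * a * y) <-> V (s' * a * x).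
  move=> s _; have [[U1 U2] [/= nU1 nU2] UV] := clopen_near (s, x) cV'.
  exists (U1, U2) => // -[s' y] [/= Us Uy].
  have /= -> := UV (s', y) (conj Us Uy).
  by have /= -> := UV (s', x) (conj Us (nbhs_singleton nU2)).
have := cA A (nbhs x) (fun y s => V (s * a * y) <-> V (s * a * x))
  (nbhs_filter x) nx.
apply: filterS => y Hy; split=> S s.
  exact: iff_trans (iff_sym (Hy s _)) (S s).
exact: iff_trans (Hy s _) (S s).
Qed.

Lemma saturation_filter V a : clopen V -> upper V ->
  clopen_filter (saturation V a).
Proof.
move=> cV upV; split; first exact: saturation_clopen.
  have le3 s x y : V (s * a * x * y) -> V (s * a * x).
    by apply: upV; exact: gr_starl.
  have le2 s x : V (s * a * x) -> V (s * a) by apply: upV; exact: gr_starl.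
  move=> x y; split=> [Sxy|[Sx Sy] s].
    split=> s; split=> [/le2//|/Sxy]; rewrite grA; first by move=> /le3.
    by rewrite grAC => /le3.
  (* By left normality [s * a * x * y] is [(s * x) * a * y], so the condition on [y] is used at
     [s * x]. *)
  by rewrite grA (grAC s) (grAC _ x) -(grAC s) Sy (grAC s) Sx.
by move=> s; rewrite grx0.
Qed.

Lemma gr_hom3_separation a b : ~ a <= b ->
  exists p : grHom3 A, ~ le3 (p a) (p b).
Proof.
(* If [a * b = a], any clopen filter containing [a] contains [b], so the separating morphism takes
   the values [T1] at [a] and [T0] at [b]. Here [V] omits [b * a] and not merely [b], because
   [b * e] is compared with [b * a] through the saturation. *)
move=> nab; have [ab|nab'] := pselect (a * b = a).
  have [V [cV upV Va Vba]] : exists V,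
      [/\ clopen V, upper V, V a & ~ V (b * a)].
    by apply: gr_clopen_upper => /gr_trans/(_ (gr_starl b a)).
  have Wf := saturation_filter a cV upV.
  have [e [We emin]] := clopen_filter_least Wf.
  have Wa : saturation V a a by move=> s; rewrite -grA grxx.
  have Wb : saturation V a b.
    by move: Wa; rewrite -{2}ab => /(cfilter_star Wf)[].
  have Vae : V (a * e) by have := We a; rewrite grxx => ->.
  have Vbe : ~ V (b * e) by have := We b; rewrite grAC -grA emin // => ->.
  have V0 : ~ V (c0 * e).
    by rewrite -(emin _ Wb) grA grAC -grA => /(upV _ _ (gr_c0l _)).
  have V1 : V (c1 * e) by exact: upV (gr_c1r _ _) Vae.
  have ph := filter_fun_hom Wf (conj We emin) cV upV V0 V1.
  exists (exist _ _ ph); rewrite /hom3_fun /= /filter_fun.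
  by rewrite asboolT // asboolT // asboolT // asboolF.
(* Otherwise the supports can be told apart: the filter will contain [a] but not [b]. Multiplying by
   [c0] on the left keeps only the information about supports. *)
have [V [cV upV Va Vb]] : exists V,
    [/\ clopen V, upper V, V (c0 * a) & ~ V (c0 * b)].
  apply: gr_clopen_upper => /gr_le_star; rewrite grA (grAC _ c0) grx0 => E.
  by apply: nab'; rewrite -{1}(grx0 a) -{1}(grxx a) (grAC a) -!grA (grA c0) E
    grA grx0 grxx.
have Wf := saturation_filter (c0 * a) cV upV.
have [e [We emin]] := clopen_filter_least Wf.
have Wa : saturation V (c0 * a) a.
  by move=> s; rewrite -!grA grxx.
have Wb : ~ saturation V (c0 * a) b.
  move=> /(_ c0); rewrite !grA grxx => /iffRL/(_ Va).
  by rewrite grAC => /(upV _ _ (gr_starl _ _)).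
(* The first upper set only served to build the filter; a second one gives the values on it. If it
   did not exist, [e] would be [ca], and a filter containing [ca] contains [b]. *)
have [V' [cV' upV' V'1 V'0]] : exists V,
    [/\ clopen V, upper V, V (c1 * e) & ~ V (c0 * e)].
  apply: gr_clopen_upper => c10.
  have /(c01_neq (gr_cst A)) ea : c0 * e = c1 * e.
    by apply: (po_anti (gr_band A)) => //; exact: gr_c1r.
  apply: Wb; move: We; rewrite ea -(star_xa (gr_cst A) b).
  by move=> /(cfilter_star Wf)[].
have ph := filter_fun_hom Wf (conj We emin) cV' upV' V'0 V'1.
exists (exist _ _ ph); rewrite /hom3_fun /= /filter_fun.
rewrite asboolT // [in X in le3 _ X]asboolF //.
by case: asboolP.
Qed.

Lemma gr_hom3_inj a b : (forall p : grHom3 A, p a = p b) -> a = b.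
Proof.
have le x y : (forall p : grHom3 A, p x = p y) -> x <= y.
  move=> E; apply: contrapT => /gr_hom3_separation[p]; rewrite E; apply.
  exact: (po_refl po_band3).
by move=> E; apply: (po_anti (gr_band A)); apply: le => p.
Qed.

End GRTheory.

(** * Morphisms into 3 are evaluations *)

Lemma grHom3_eq (A : gr_space) (p q : grHom3 A) :
  (forall a, p a = q a) -> p = q.
Proof.
case: p q => p Pp [q Pq] /= /funext pq; case: _ / pq Pq => Pq.
by rewrite (Prop_irrelevance Pp Pq).
Qed.

Lemma grHom3_continuous (A : gr_space) (p : grHom3 A) : continuous p.
Proof. exact: (grhom_cont (proj2_sig p)). Qed.

Lemma grHom3_star (A : gr_space) (p : grHom3 A) (x y : A) :
  p (gr_star x y) = star3 (p x) (p y).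
Proof. exact: (grhom_star (proj2_sig p)). Qed.

Lemma grHom3_le (A : gr_space) (p : grHom3 A) (x y : A) :
  gr_le x y -> le3 (p x) (p y).
Proof. exact: (grhom_le (proj2_sig p)). Qed.

Lemma grHom3_c0 (A : gr_space) (p : grHom3 A) : p (gr_c0 A) = T0.
Proof. exact: (grhom_c0 (proj2_sig p)). Qed.

Lemma grHom3_c1 (A : gr_space) (p : grHom3 A) : p (gr_c1 A) = T1.
Proof. exact: (grhom_c1 (proj2_sig p)). Qed.

Lemma grHom3_ca (A : gr_space) (p : grHom3 A) : p (gr_ca A) = Ta.
Proof. exact: (grhom_ca (proj2_sig p)). Qed.

Lemma star3_Ta u v : star3 u v <> Ta <-> u <> Ta /\ v <> Ta.
Proof. by case: u; case: v; split=> // -[]. Qed.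

Lemma add3_Ta u v : add3 u v <> Ta <-> u <> Ta /\ v <> Ta.
Proof. by case: u; case: v; split=> // -[]. Qed.

Lemma mul3_Ta u v : mul3 u v <> Ta <-> u <> Ta /\ v <> Ta.
Proof. by case: u; case: v; split=> // -[]. Qed.

Lemma not_le3 u v : ~ le3 u v -> v <> Ta -> u = T1 /\ v = T0.
Proof. by rewrite /le3; case: u; case: v => // -[]. Qed.

(** The band operation is a term of the algebra, so within the algebra an element can be cut down to
    the support of another. *)
Lemma mul3_add3 u v : mul3 u (add3 u v) = star3 u v.
Proof. by case: u; case: v. Qed.

Lemma grHom3_clopen_filter (A : gr_space) (p : grHom3 A) :
  clopen_filter [set x | p x <> Ta].
Proof.
split.
- exact: (continuous3_clopen [set v | v <> Ta] (@grHom3_continuous A p)).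
- by move=> x y /=; rewrite grHom3_star; exact: star3_Ta.
- by rewrite /= grHom3_c0.
Qed.

(** * Every morphism from the dual of [B] into 3 is an evaluation *)

Section BdualEval.
Variable B : ibsl.
Implicit Types (b d x y : B) (h k : bdual B).

Lemma bdualM h x y : h (ib_mul x y) = mul3 (h x) (h y).
Proof. exact: (bhom_mul (proj2_sig h)). Qed.

Lemma bdualD h x y : h (ib_add x y) = add3 (h x) (h y).
Proof. exact: (bhom_add (proj2_sig h)). Qed.

Lemma bdual_starE h k x : bdual_star h k x = star3 (h x) (k x).
Proof. by []. Qed.

Lemma bdual_eval_hom b : is_gr_hom ((fun h => h b) : bdual_gr B -> GR3).
Proof. by split=> // [|h k]; [exact: bdual_eval_continuous|exact]. Qed.

Definition bdual_eval b : grHom3 (bdual_gr B) := exist _ _ (bdual_eval_hom b).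

Lemma bdual_eval_inj x y : (forall h, h x = h y) -> x = y.
Proof.
move=> E; apply: contrapT => /bhom_separation[h hh]; apply.
exact: (E (exist _ h hh)).
Qed.

(** Although [h] may ignore the involution, b = b * (- b + b) forces [h (- b) <> Ta]. So [h] is not
    [Ta] at [lzero b], which equals [lzero b + lzero x]. *)
Lemma bdual_below h b x : below b x -> h b <> Ta -> h x <> Ta.
Proof.
move=> bx hb.
have hb' : h (ib_inv b) <> Ta.
  have := hb; rewrite -{1}(ib_mulxx b) -ib_mul_inv_add.
  by rewrite bdualM bdualD => /mul3_Ta[_ /add3_Ta[]].
have : h (lzero b) <> Ta by rewrite bdualM; apply/mul3_Ta.
by rewrite -bx bdualD bdualM => /add3_Ta[_]; rewrite bdualM => /mul3_Ta[].
Qed.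

Lemma below_fun0 b x :
  below_fun b set0 x = if `[< below b x >] then T0 else Ta.
Proof. by rewrite /below_fun; case: asboolP => // _; case: asboolP. Qed.

Definition bdual_indicator b : bdual B := exist _ _ (below_bhom b).

Lemma bdual_indicatorE b x :
  bdual_indicator b x = if `[< below b x >] then T0 else Ta.
Proof. exact: below_fun0. Qed.

Lemma bdual_zero h x : h x <> Ta -> h (ib_zero B) <> Ta.
Proof. by rewrite -{1}(ib_add0x x) bdualD => /add3_Ta[]. Qed.

Section Surjectivity.
Variable p : grHom3 (bdual_gr B).

Let p_star h k : p (bdual_star h k) = star3 (p h) (p k).
Proof. exact: (grHom3_star p h k). Qed.

Lemma hom3_support : exists b, forall h, p h <> Ta <-> h b <> Ta.
Proof.
have Wf := grHom3_clopen_filter p.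
have [e [/= We emin]] := clopen_filter_least Wf.
have eE h x : p h <> Ta -> bdual_fun e x <> Ta -> h x <> Ta.
  move=> /emin ehE; rewrite -(ehE : bdual_star e h = e) bdual_starE.
  by move=> /star3_Ta[].
have [oW _] := cfilter_clopen Wf.
have [s sW] : nbhs e [set h | p h <> Ta] by exact: open_nbhs_nbhs.
(* [p] is [Ta] at the constant c_alpha, so [e] is not that constant; its support is therefore
   nonempty and contains the neutral element of the sum. *)
have e0 : bdual_fun e (ib_zero B) <> Ta.
  have [[x ex]|ne] := pselect (exists x, bdual_fun e x <> Ta).
    exact: bdual_zero ex.
  exfalso; apply: We; rewrite -(grHom3_ca p); congr (p _).
  apply: bdual_eq => x; apply: contrapT => ex; apply: ne; by exists x.
(* [s] lists the finitely many coordinates that define a neighbourhood of [e] inside the support of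
   [p]; [b] sums those where [e] is not [Ta]. *)
pose f x b := if `[< bdual_fun e x = Ta >] then b else ib_add x b.
pose b := foldr f (ib_zero B) s.
have eb : bdual_fun e b <> Ta.
  rewrite /b; elim: (s) => //= x t IHt; rewrite /f; case: asboolP => // ex.
  by rewrite bdualD; apply/add3_Ta.
(* [k] agrees with [e] on [s], so [p k <> Ta], and hence [p] is not [Ta] at the indicator of [b]. *)
pose k := bdual_star e (bdual_indicator b).
have pk : p k <> Ta.
  apply: sW => /=; have : below b b by exact: below_refl.
  rewrite {2}/b; elim: (s) => //= x t IHt; rewrite {1}/f below_fun0.
  case: asboolP => [ex /IHt->|ex /belowD[bx /IHt->]].
    by congr (_ :: _); rewrite ex; case: asboolP.
  by congr (_ :: _); rewrite asboolT.
move: pk; rewrite p_star => /star3_Ta[_ pb].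
exists b => h; split=> [ph|hb]; first exact: eE.
(* The indicator has the least support among the points that are not [Ta] at [b]. *)
have E : bdual_star (bdual_indicator b) h = bdual_indicator b.
  apply: bdual_eq => x; rewrite bdual_starE bdual_indicatorE.
  case: asboolP => bx; last by case: (h x).
  by have := bdual_below bx hb; case: (h x).
by have := pb; rewrite -E p_star => /star3_Ta[].
Qed.

Lemma hom3_is_eval : exists b, forall h, p h = h b.
Proof.
have [b pb] := hom3_support.
pose par d := forall h, p h <> Ta <-> h d <> Ta.
have parM d d' : par d -> par d' -> par (ib_mul d d').
  move=> pd pd' h; rewrite bdualM; split=> [ph|/mul3_Ta[/pd//]].
  by apply/mul3_Ta; split; [exact/pd|exact/pd'].
have parD d d' : par d -> par d' -> par (ib_add d d').
  move=> pd pd' h; rewrite bdualD; split=> [ph|/add3_Ta[/pd//]].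
  by apply/add3_Ta; split; [exact/pd|exact/pd'].
have sep h k : p h = T1 -> p k = T0 ->
    exists d, [/\ par d, h d = T1 & k d = T0].
  move=> ph pk; pose i := bdual_indicator b.
  have pi : p i <> Ta.
    by apply/pb; rewrite bdual_indicatorE asboolT //; exact: below_refl.
  (* Multiplying by the indicator forces the coordinate that distinguishes [h] from [k] to lie below
     [b]. *)
  have /existsNP[x] : ~ bdual_le (bdual_star h i) (bdual_star k i).
    move=> /(@grHom3_le _ p); rewrite !p_star ph pk.
    by case: (p i) pi.
  rewrite !bdual_starE bdual_indicatorE; case: asboolP => [bx hkx|_ []//].
  have hb : h b <> Ta by apply/pb; rewrite ph.
  have kb : k b <> Ta by apply/pb; rewrite pk.
  have [/= hx kx] := not_le3 hkx (bdual_below bx kb).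
  (* The term of [mul3_add3] cuts [x] down to the support given by [b], which is that of [p]. *)
  exists (ib_mul x (ib_add x b)); split.
  - move=> l; rewrite bdualM bdualD mul3_add3; split=> [/pb lb|].
      by apply/star3_Ta; split=> //; exact: bdual_below bx lb.
    by move=> /star3_Ta[_ /pb].
  - by rewrite bdualM bdualD mul3_add3 hx; case: (h b) hb.
  - by rewrite bdualM bdualD mul3_add3 kx; case: (k b) kb.
have closed_p (P : set three) : closed [set k : bdual_gr B | P (p k)].
  exact: (continuous3_clopen P (@grHom3_continuous _ p)).2.
have closed_e d (P : set three) :
    closed [set k : bdual_gr B | P (bdual_fun k d)].
  exact: (continuous3_clopen P (@bdual_eval_continuous B d)).2.
have sep0 h : p h = T1 ->
    exists d, [/\ par d, h d = T1 & forall k, p k = T0 -> k d = T0].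
  move=> ph; apply: contrapT => nd.
  (* First compactness: if each candidate [d] fails at some [k], products of candidates make the
     failure sets directed, and a common [k] contradicts [sep]. *)
  have [|d _|d [pd hd]|d d' [pd hd] [pd' hd']|k Hk] :=
    @compact_directed (bdual_gr B) B (fun d => par d /\ h d = T1)
      (fun d => [set k | p k = T0] `&` [set k | bdual_fun k d <> T0])
      (@gr_compact _).
  - by have [d [pd hd _]] := sep _ _ ph (grHom3_c0 p); exists d.
  - by apply: closedI; [exact: (closed_p [set T0])|
      exact: (closed_e d (~` [set T0]))].
  - apply: contrapT => nk; apply: nd; exists d; split=> // k pk.
    by apply: contrapT => kd; apply: nk; exists k.
  - exists (ib_mul d d'); first by split; [exact: parM|rewrite bdualM hd hd'].
    move=> k [/= pk]; rewrite bdualM => kdd.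
    have kd : bdual_fun k d <> Ta by apply/pd; rewrite pk.
    have kd' : bdual_fun k d' <> Ta by apply/pd'; rewrite pk.
    by move: kdd kd kd'; case: (bdual_fun k d); case: (bdual_fun k d').
  - have [d [pd hd _]] := sep _ _ ph (grHom3_c0 p).
    have pk := (Hk d (conj pd hd)).1.
    have [d' [pd' hd' kd']] := sep _ _ ph pk.
    exact: (Hk d' (conj pd' hd')).2 kd'.
have [d [pd d0 d1]] : exists d, [/\ par d,
    forall k, p k = T0 -> k d = T0 & forall h, p h = T1 -> h d = T1].
  apply: contrapT => nd.
  (* Second compactness, now over [h], with sums of candidates in place of products. *)
  have [|d _|d [pd hd]|d d' [pd hd] [pd' hd']|h Hh] :=
    @compact_directed (bdual_gr B) B
      (fun d => par d /\ forall k, p k = T0 -> k d = T0)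
      (fun d => [set h | p h = T1] `&` [set h | bdual_fun h d <> T1])
      (@gr_compact _).
  - by have [d [pd _ hd]] := sep0 _ (grHom3_c1 p); exists d.
  - by apply: closedI; [exact: (closed_p [set T1])|
      exact: (closed_e d (~` [set T1]))].
  - apply: contrapT => nk; apply: nd; exists d; split=> // k pk.
    by apply: contrapT => kd; apply: nk; exists k.
  - exists (ib_add d d').
      by split=> [|k pk]; [exact: parD|rewrite bdualD hd // hd'].
    move=> k [/= pk]; rewrite bdualD => kdd.
    have kd : bdual_fun k d <> Ta by apply/pd; rewrite pk.
    have kd' : bdual_fun k d' <> Ta by apply/pd'; rewrite pk.
    by move: kdd kd kd'; case: (bdual_fun k d); case: (bdual_fun k d').
  - have [d [pd _ hd]] := sep0 _ (grHom3_c1 p).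
    have ph := (Hh d (conj pd hd)).1.
    have [d' [pd' hd' kd']] := sep0 _ ph.
    exact: (Hh d' (conj pd' kd')).2 hd'.
exists d => h; case E : (p h); [by rewrite d0|by rewrite d1|].
by apply: contrapT => hd; apply: (iffRL (pd h)) E => hd'; apply: hd.
Qed.

End Surjectivity.
End BdualEval.

(** * The algebra of morphisms of a space into 3, and its points *)

Section Hom3Algebra.
Variable A : igr.
Implicit Types p q r : grHom3 A.

Lemma mul_hom3 p q : is_gr_hom ((fun a => mul3 (p a) (q a)) : A -> GR3).
Proof.
split; rewrite ?grHom3_c0 ?grHom3_c1 ?grHom3_ca //.
- apply/continuous3P => x.
  have /continuous3P/(_ x) cp := @grHom3_continuous A p.
  have /continuous3P/(_ x) cq := @grHom3_continuous A q.
  by apply: filterS2 cp cq => y /= -> ->.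
- move=> x y; rewrite !grHom3_star.
  by case: (p x) (p y) (q x) (q y) => -[] [] [].
- move=> x y xy; move: (grHom3_le p xy) (grHom3_le q xy).
  by case: (p x) (p y) (q x) (q y) => -[] [] [].
Qed.

Lemma add_hom3 p q : is_gr_hom ((fun a => add3 (p a) (q a)) : A -> GR3).
Proof.
split; rewrite ?grHom3_c0 ?grHom3_c1 ?grHom3_ca //.
- apply/continuous3P => x.
  have /continuous3P/(_ x) cp := @grHom3_continuous A p.
  have /continuous3P/(_ x) cq := @grHom3_continuous A q.
  by apply: filterS2 cp cq => y /= -> ->.
- move=> x y; rewrite !grHom3_star.
  by case: (p x) (p y) (q x) (q y) => -[] [] [].
- move=> x y xy; move: (grHom3_le p xy) (grHom3_le q xy).
  by case: (p x) (p y) (q x) (q y) => -[] [] [].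
Qed.

Lemma inv_hom3 p : is_gr_hom ((fun a => inv3 (p (igr_neg a))) : A -> GR3).
Proof.
have [N0 N1 Na] := igr_G4 A.
split; rewrite ?(N0, N1, Na) ?grHom3_c0 ?grHom3_c1 ?grHom3_ca //.
- apply/continuous3P => x.
  have /continuous3P/(_ (igr_neg x)) cp := @grHom3_continuous A p.
  have : nbhs x (@igr_neg A @^-1` [set y | p y = p (igr_neg x)]).
    exact: (@igr_neg_cont A x).
  by apply: filterS => y /= ->.
- move=> x y; rewrite igr_G2 grHom3_star.
  by case: (p _) (p _) => -[].
(* Both halves of the relation in (G3) matter: the equation compares the supports, the inequality
   the values on them. *)
- move=> x y /igr_G3[]; move=> /(grHom3_le p) + /(congr1 p).
  by rewrite !grHom3_star; case: (p _) (p _) => -[].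
Qed.

Definition hom3_mul p q : grHom3 A := exist _ _ (mul_hom3 p q).
Definition hom3_add p q : grHom3 A := exist _ _ (add_hom3 p q).
Definition hom3_inv p : grHom3 A := exist _ _ (inv_hom3 p).
Definition hom3_bot : grHom3 A := sval (cid (igr_G6 A)).

Lemma hom3_botP : hom3_zero hom3_bot.
Proof. by rewrite /hom3_bot; case: cid => p0 [p1 []]. Qed.

Lemma hom3_mul_fun p q a : hom3_mul p q a = mul3 (p a) (q a).
Proof. by []. Qed.

Lemma hom3_add_fun p q a : hom3_add p q a = add3 (p a) (q a).
Proof. by []. Qed.

Lemma hom3_inv_fun p a : hom3_inv p a = inv3 (p (igr_neg a)).
Proof. by []. Qed.

Let hom3E := (hom3_mul_fun, hom3_add_fun, hom3_inv_fun).

Lemma hom3_addxx p : hom3_add p p = p.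
Proof. by apply: grHom3_eq => a; rewrite hom3E; case: (p a). Qed.

Lemma hom3_addC p q : hom3_add p q = hom3_add q p.
Proof.
by apply: grHom3_eq => a; rewrite !hom3E; case: (p a); case: (q a).
Qed.

Lemma hom3_addA p q r :
  hom3_add p (hom3_add q r) = hom3_add (hom3_add p q) r.
Proof.
apply: grHom3_eq => a; rewrite !hom3E.
by case: (p a); case: (q a); case: (r a).
Qed.

Lemma hom3_invK p : hom3_inv (hom3_inv p) = p.
Proof. by apply: grHom3_eq => a; rewrite !hom3E igr_G1; case: (p a). Qed.

Lemma hom3_mulE p q :
  hom3_mul p q = hom3_inv (hom3_add (hom3_inv p) (hom3_inv q)).
Proof.
by apply: grHom3_eq => a; rewrite !hom3E igr_G1; case: (p a); case: (q a).
Qed.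

Lemma hom3_mul_inv_add p q :
  hom3_mul p (hom3_add (hom3_inv p) q) = hom3_mul p q.
Proof.
by apply: grHom3_eq => a; rewrite !hom3E igr_G5; case: (p a); case: (q a).
Qed.

Lemma hom3_add0x p : hom3_add hom3_bot p = p.
Proof.
by rewrite hom3_addC; apply: grHom3_eq => a; exact: hom3_botP.
Qed.

Definition hom3_ibsl : ibsl := IBSLAlgebra hom3_addxx hom3_addC hom3_addA
  hom3_invK hom3_mulE hom3_mul_inv_add hom3_add0x (erefl (hom3_inv hom3_bot)).

Section Surjectivity.
Variable h : bdual hom3_ibsl.

Let hM p q : h (hom3_mul p q) = mul3 (h p) (h q).
Proof. exact: (@bdualM hom3_ibsl). Qed.

Let hD p q : h (hom3_add p q) = add3 (h p) (h q).
Proof. exact: (@bdualD hom3_ibsl). Qed.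

Let closed_val p (P : set three) : closed [set a : A | P (p a)].
Proof. exact: (continuous3_clopen P (@grHom3_continuous A p)).2. Qed.

(** Compactness over the [p] with [h p <> Ta], directed under sums. For a single [p], a least [e] of
    its support works: if [q e <> Ta], then [q] is not [Ta] on the whole support of [p], so p * (p +
    q) = p and [h q] cannot be [Ta]. *)
Lemma bdual_hom3_support : (exists p, h p <> Ta) ->
  exists e, forall p, p e = Ta <-> h p = Ta.
Proof.
move=> [p0 hp0].
have [|p _|p hp|p q hp hq|e He] := @compact_directed A (grHom3 A)
    [set p : grHom3 A | h p <> Ta] (fun p : grHom3 A => [set a | p a <> Ta] `&`
      \bigcap_(q in [set q : grHom3 A | h q = Ta]) [set a | q a = Ta])
    (@gr_compact A).
- by exists p0.
- apply: closedI; first exact: (@closed_val p [set v | v <> Ta]).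
  by apply: closed_bigI => q _; exact: (@closed_val q [set Ta]).
- have [e [/= We emin]] := clopen_filter_least (grHom3_clopen_filter p).
  exists e; split=> // q /= hq; apply: contrapT => qe.
  have E : hom3_mul p (hom3_add p q) = p.
    apply: grHom3_eq => a; rewrite !hom3E mul3_add3.
    have [->|/emin ea] := pselect (p a = Ta); first by case: (q a).
    by move: qe; rewrite -ea grHom3_star => /star3_Ta[_]; case: (q a).
  by apply: hp; rewrite /= -E hM hD mul3_add3 hq.
- exists (hom3_add p q); first by rewrite /= hD; exact/add3_Ta.
  by move=> a [/= /add3_Ta[pa qa] Ha].
exists e => p; split=> [pe|hp]; last exact: (He _ hp0).2.
by apply: contrapT => /He[].
Qed.

Lemma bdual_hom3_value : exists a, forall p, h p <> Ta -> p a = h p.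
Proof.
(* When [h] omits [T1] or [T0], one of the constants c_0, c_1 realises its values; the compactness
   argument needs both values to occur. *)
have [[p1 hp1]|n1] := pselect (exists p, h p = T1); last first.
  exists (gr_c0 A) => p hp; rewrite grHom3_c0.
  by case E : (h p) hp => // _; exfalso; apply: n1; exists p.
have [[p0 hp0]|n0] := pselect (exists p, h p = T0); last first.
  exists (gr_c1 A) => p hp; rewrite grHom3_c1.
  by case E : (h p) hp => // _; exfalso; apply: n0; exists p.
have [|[p q] _|[p q] [/= hp hq]|[p q] [p' q'] [/= hp hq] [/= hp' hq']|a Ha] :=
  @compact_directed A (grHom3 A * grHom3 A)
    [set r : grHom3 A * grHom3 A | h r.1 = T1 /\ h r.2 = T0]
    (fun r : grHom3 A * grHom3 A =>
      [set a | r.1 a = T1] `&` [set a | r.2 a = T0]) (@gr_compact A).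
- by exists (p1, p0).
- by apply: closedI; [exact: (@closed_val p [set T1])|
    exact: (@closed_val q [set T0])].
- apply: contrapT => na.
  (* [u] and [v] are [p] and [q] cut down to their common support. If no point gave them [T1] and
     [T0], then u * v = u, although [h] sends [u] to [T1] and [v] to [T0]. *)
  pose u := hom3_mul p (hom3_add p q); pose v := hom3_mul q (hom3_add q p).
  have E : hom3_mul u v = u.
    apply: grHom3_eq => a.
    have : ~ (p a = T1 /\ q a = T0) by move=> pq; apply: na; exists a.
    rewrite !hom3E !mul3_add3.
    by case: (p a); case: (q a) => // -[].
  by have := congr1 h E; rewrite !hM !hD hp hq.
- exists (hom3_mul p p', hom3_add q q').
    by split; rewrite /= ?hM ?hD ?hp ?hp' ?hq ?hq'.
  move=> a [] /=.
  by case: (p a); case: (p' a) => //; case: (q a); case: (q' a).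
exists a => p hp; case E : (h p) hp => // _.
  exact: (Ha (p1, p) (conj hp1 E)).2.
exact: (Ha (p, p0) (conj E hp0)).1.
Qed.

Lemma bdual_is_eval : exists a, forall p, h p = p a.
Proof.
have [hp|n] := pselect (exists p, h p <> Ta); last first.
  exists (gr_ca A) => p; rewrite grHom3_ca.
  by apply: contrapT => hp; apply: n; exists p.
have [e He] := bdual_hom3_support hp; have [a Ha] := bdual_hom3_value.
(* [a] supplies the values and [e] the support. *)
exists (gr_star a e) => p; rewrite grHom3_star.
have [/[dup] hpa /He ->|hpa] := pselect (h p = Ta); first by rewrite hpa.
have : p e <> Ta by move=> /He.
by rewrite Ha //; case: (p e).
Qed.

End Surjectivity.
End Hom3Algebra.

(** * The duality *)

Section BdualIGR.
Variable B : ibsl.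
Implicit Types h k : bdual B.

Lemma bdual_neg_continuous :
  continuous (@bdual_neg B : bdual_gr B -> bdual_gr B).
Proof.
apply: continuous_to_bdual => b; apply/continuous3P => h.
have /continuous3P/(_ h) := @bdual_eval_continuous B (ib_inv b).
by apply: filterS => k; exact: (congr1 inv3).
Qed.

Lemma bdual_G1 h : bdual_neg (bdual_neg h) = h.
Proof.
apply: bdual_eq => b; rewrite /bdual_fun /= /bdual_fun /= ib_invK.
by case: (sval h b).
Qed.

Lemma bdual_G2 h k :
  bdual_neg (bdual_star h k) = bdual_star (bdual_neg h) (bdual_neg k).
Proof.
apply: bdual_eq => b; rewrite /bdual_fun /= /bdual_fun.
by case: (sval h _); case: (sval k _).
Qed.

Lemma bdual_G3 h k : bdual_le h k ->
  gr_sqle (bdual_neg k : bdual_gr B) (bdual_neg h).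
Proof.
move=> hk; split=> [b|].
  move: (hk (ib_inv b)); rewrite /bdual_fun /= /bdual_fun /= /bdual_fun.
  by case: (sval h _); case: (sval k _).
apply: bdual_eq => b; move: (hk (ib_inv b)).
rewrite /bdual_fun /= /bdual_fun /= /bdual_fun.
by case: (sval h _); case: (sval k _).
Qed.

(** As [p] and [q] are evaluations at elements of [B], this is the axiom [ib_mul_inv_add] for these
    elements. *)
Lemma bdual_G5 (p q : grHom3 (bdual_gr B)) (h : bdual_gr B) :
  mul3 (p h) (add3 (inv3 (p (bdual_neg h))) (q h)) = mul3 (q h) (p h).
Proof.
have [x px] := hom3_is_eval p; have [y qy] := hom3_is_eval q.
rewrite !px qy -bdualM ib_mulC -ib_mul_inv_add bdualM bdualD.
by rewrite /bdual_fun /= /bdual_fun; case: (sval h (ib_inv x)).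
Qed.

Lemma bdual_eval_zero : hom3_zero (bdual_eval (ib_zero B)).
Proof.
move=> p h; have [x px] := hom3_is_eval p; rewrite px.
by rewrite -[in RHS](ib_add0x x) ib_addC bdualD.
Qed.

Lemma bdual_G6 : exists p0 p1 : grHom3 (bdual_gr B),
  (forall h, inv3 (p0 (bdual_neg h)) = p1 h) /\ hom3_zero p0.
Proof.
exists (bdual_eval (ib_zero B)), (bdual_eval (ib_one B)).
split; last exact: bdual_eval_zero.
move=> h; rewrite /hom3_fun /= /bdual_fun /= /bdual_fun ib_oneE.
by case: (sval h _).
Qed.

Lemma bdual_G4 : [/\ bdual_neg (bdual_const B T0) = bdual_const B T1,
  bdual_neg (bdual_const B T1) = bdual_const B T0
  & bdual_neg (bdual_const B Ta) = bdual_const B Ta].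
Proof. by split; apply: bdual_eq. Qed.

Definition bdual_igr : igr := @IGRSpace (bdual_gr B) (@bdual_neg B)
  bdual_neg_continuous bdual_G1 bdual_G2 bdual_G3 bdual_G4 bdual_G5 bdual_G6.

Lemma bdual_hausdorff : hausdorff_space (bdual B).
Proof.
move=> h k hk; apply: bdual_eq => b.
have /continuous3P cb := @bdual_eval_continuous B b.
by have [l [/= <- <-]] := hk _ _ (cb h) (cb k).
Qed.

End BdualIGR.

(** * Action on arrows, and the units with their inverses *)

Definition hom3_pull (A B : igr) (f : A -> B) (fh : is_igr_hom f)
  (p : hom3_ibsl B) : hom3_ibsl A :=
  exist _ _ (is_gr_hom_comp (proj2_sig p) (igrhom_gr fh)).

Lemma hom3_pull_reduct (A B : igr) (f : A -> B) (fh : is_igr_hom f) :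
  is_reduct_hom (hom3_pull fh).
Proof.
split=> [p q|p q|p]; apply: grHom3_eq => a //.
by rewrite /hom3_fun /= /hom3_fun /= (igrhom_neg fh).
Qed.

(** The zero of the algebra is phi_0, so the extra condition on arrows makes the pullback fix zero;
    it then fixes one through the involution. *)
Lemma hom3_pull_ibsl (A B : igr) (f : A -> B) (fh : is_igr_hom0 f) :
  is_ibsl_hom (hom3_pull (igrhom0_hom fh)).
Proof.
have E : hom3_pull (igrhom0_hom fh) (ib_zero _) = ib_zero (hom3_ibsl A).
  apply: grHom3_eq => a.
  exact: (igrhom0_zero fh (@hom3_botP A) (@hom3_botP B)).
have pr := hom3_pull_reduct (igrhom0_hom fh).
by split=> //; rewrite !ib_oneE (rhom_inv pr) E.
Qed.

Lemma comp_bhom (A B : ibsl) (f : A -> B) (fh : is_reduct_hom f) (h : bdual B) :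
  is_bhom (h \o f).
Proof.
by split=> x y /=; rewrite ?(rhom_mul fh) ?(rhom_add fh) ?bdualM ?bdualD.
Qed.

Definition bdual_pull (A B : ibsl) (f : A -> B) (fh : is_reduct_hom f)
  (h : bdual_igr B) : bdual_igr A := exist _ _ (comp_bhom fh h).

Lemma bdual_pull_igr (A B : ibsl) (f : A -> B) (fh : is_reduct_hom f) :
  is_igr_hom (bdual_pull fh).
Proof.
split; last first.
  by move=> h; apply: bdual_eq => x; rewrite /bdual_fun /= (rhom_inv fh).
split=> [|h k||||h k hk x]; try exact: bdual_eq; last exact: hk.
apply: continuous_to_bdual => x; exact: bdual_eval_continuous.
Qed.

Lemma bdual_pull_igr0 (A B : ibsl) (f : A -> B) (fh : is_ibsl_hom f) :
  is_igr_hom0 (bdual_pull (hom_reduct fh)).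
Proof.
split; first exact: bdual_pull_igr.
move=> p0 q0 zp zq h.
rewrite (hom3_zero_unique zq (@bdual_eval_zero A)).
rewrite (hom3_zero_unique zp (@bdual_eval_zero B)).
by rewrite /hom3_fun /= /bdual_fun /= (hom_zero fh).
Qed.

Lemma eval_bhom (A : igr) (a : A) :
  is_bhom ((fun p : grHom3 A => p a) : hom3_ibsl A -> three).
Proof. by []. Qed.

Definition igr_unit (A : igr) (a : A) : bdual_igr (hom3_ibsl A) :=
  exist _ _ (eval_bhom a).

Lemma igr_unit_hom (A : igr) : is_igr_hom (@igr_unit A).
Proof.
split; last first.
  move=> a; apply: bdual_eq => p.
  rewrite -[RHS]/(inv3 (inv3 (hom3_fun p (igr_neg a)))).
  by rewrite -[LHS]/(hom3_fun p (igr_neg a)); case: (hom3_fun p _).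
split=> [|a b||||a b ab p].
- by apply: continuous_to_bdual => p; exact: grHom3_continuous.
- by apply: bdual_eq => p; exact: grHom3_star.
- by apply: bdual_eq => p; exact: grHom3_c0.
- by apply: bdual_eq => p; exact: grHom3_c1.
- by apply: bdual_eq => p; exact: grHom3_ca.
- exact: (grHom3_le p ab).
Qed.

Lemma igr_unit_hom0 (A : igr) : is_igr_hom0 (@igr_unit A).
Proof.
split; first exact: igr_unit_hom.
move=> p0 q0 zp zq a; rewrite (hom3_zero_unique zq (@bdual_eval_zero _)).
exact: (hom3_zero_unique (@hom3_botP A) zp).
Qed.

Lemma igr_unit_inj (A : igr) : injective (@igr_unit A).
Proof.
move=> a b E; apply: gr_hom3_inj => p.
exact: (congr1 (fun h : bdual (hom3_ibsl A) => h p) E).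
Qed.

(** Bijectivity alone would not make the inverse of the unit monotone; separation by morphisms
    does. *)
Lemma igr_unit_le (A : igr) (a b : A) :
  gr_le (igr_unit a) (igr_unit b) -> gr_le a b.
Proof.
by move=> ab; apply: contrapT => /gr_hom3_separation[p]; apply; exact: ab.
Qed.

Lemma igr_unit_surj (A : igr) (h : bdual_igr (hom3_ibsl A)) :
  exists a, igr_unit a = h.
Proof.
have [a ha] := bdual_is_eval h; exists a.
by apply: bdual_eq => p; rewrite ha.
Qed.

Definition igr_counit (A : igr) (h : bdual_igr (hom3_ibsl A)) : A :=
  sval (cid (igr_unit_surj h)).

Lemma igr_counitK (A : igr) : cancel (@igr_counit A) (@igr_unit A).
Proof. by move=> h; rewrite /igr_counit; case: cid. Qed.

Lemma igr_unitK (A : igr) : cancel (@igr_unit A) (@igr_counit A).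
Proof. by move=> a; apply: igr_unit_inj; rewrite igr_counitK. Qed.

Lemma igr_counit_hom (A : igr) : is_igr_hom (@igr_counit A).
Proof.
have [[uc us u0 u1 ua _] un] := igr_unit_hom A.
have inj := @igr_unit_inj A; have K := @igr_counitK A.
split; last by move=> h; apply: inj; rewrite un !K.
split.
- apply/continuousP => U oU.
  (* The unit is a continuous bijection from a compact space to a Hausdorff space, hence closed. *)
  have -> : @igr_counit A @^-1` U = ~` (@igr_unit A @` (~` U)).
    rewrite predeqE => h; split=> [Uh [a Ua ah]|Uh].
      by apply: Ua; rewrite -(igr_unitK a) ah.
    by apply: contrapT => nU; apply: Uh; exists (igr_counit h).
  apply: closed_openC; apply: compact_closed; first exact: bdual_hausdorff.
  apply: continuous_compact; first exact: continuous_subspaceT.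
  apply: (subclosed_compact _ (@gr_compact A)) => //.
  exact: open_closedC.
- by move=> h k; apply: inj; rewrite us !K.
- by apply: inj; rewrite u0 K.
- by apply: inj; rewrite u1 K.
- by apply: inj; rewrite ua K.
- by move=> h k hk; apply: igr_unit_le; rewrite !K.
Qed.

Lemma igr_counit_hom0 (A : igr) : is_igr_hom0 (@igr_counit A).
Proof.
split; first exact: igr_counit_hom.
move=> p0 q0 zp zq h; rewrite -{2}(igr_counitK h).
by rewrite (igrhom0_zero (igr_unit_hom0 A) zq zp).
Qed.

Definition ibsl_unit (B : ibsl) (b : B) : hom3_ibsl (bdual_igr B) :=
  bdual_eval b.

Lemma ibsl_unit_reduct (B : ibsl) : is_reduct_hom (@ibsl_unit B).
Proof.
split=> [x y|x y|x]; apply: grHom3_eq => h.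
- exact: (bdualM h).
- exact: (bdualD h).
- rewrite /hom3_fun /= /hom3_fun /= /bdual_fun /= /bdual_fun.
  by case: (sval h _).
Qed.

Lemma ibsl_unit_hom (B : ibsl) : is_ibsl_hom (@ibsl_unit B).
Proof.
have r := ibsl_unit_reduct B.
have E : ibsl_unit (ib_zero B) = ib_zero _.
  apply: grHom3_eq.
  exact: hom3_zero_unique (@bdual_eval_zero B) (@hom3_botP (bdual_igr B)).
by split=> //; rewrite !ib_oneE (rhom_inv r) E.
Qed.

Lemma ibsl_unit_inj (B : ibsl) : injective (@ibsl_unit B).
Proof.
move=> x y E; apply: bdual_eval_inj => h.
exact: (congr1 (fun p : grHom3 (bdual_gr B) => p h) E).
Qed.

Lemma ibsl_unit_surj (B : ibsl) (p : hom3_ibsl (bdual_igr B)) :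
  exists b, ibsl_unit b = p.
Proof.
have [b pb] := hom3_is_eval p; exists b.
by apply: grHom3_eq => h; rewrite pb.
Qed.

Definition ibsl_counit (B : ibsl) (p : hom3_ibsl (bdual_igr B)) : B :=
  sval (cid (ibsl_unit_surj p)).

Lemma ibsl_counitK (B : ibsl) : cancel (@ibsl_counit B) (@ibsl_unit B).
Proof. by move=> p; rewrite /ibsl_counit; case: cid. Qed.

Lemma ibsl_unitK (B : ibsl) : cancel (@ibsl_unit B) (@ibsl_counit B).
Proof. by move=> b; apply: ibsl_unit_inj; rewrite ibsl_counitK. Qed.

Lemma ibsl_counit_reduct (B : ibsl) : is_reduct_hom (@ibsl_counit B).
Proof.
have [uM uD uI] := ibsl_unit_reduct B.
have inj := @ibsl_unit_inj B; have K := @ibsl_counitK B.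
by split=> [p q|p q|p]; apply: inj; rewrite ?(uM, uD, uI) !K.
Qed.

Lemma ibsl_counit_hom (B : ibsl) : is_ibsl_hom (@ibsl_counit B).
Proof.
have [_ u0 u1] := ibsl_unit_hom B.
have inj := @ibsl_unit_inj B; have K := @ibsl_counitK B.
by split; [exact: ibsl_counit_reduct|by apply: inj; rewrite K..].
Qed.

(** The evaluation maps go from the identity to the composites, the direction opposite to the one in
    [dually_equivalent]. *)
Lemma naturally_isomorphic_sym (C D : category) (F G : functor C D) :
  naturally_isomorphic F G -> naturally_isomorphic G F.
Proof.
move=> [eta [nat iso]]; pose eps a := sval (cid (iso a)).
have epsP a : compm (eps a) (eta a) = idm _ /\ compm (eta a) (eps a) = idm _.
  by rewrite /eps; case: cid.
exists eps; split=> [a b f|a]; last by exists (eta a); have [] := epsP a.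
rewrite -[LHS]compm1 -(epsP a).2 -compmA (compmA (fmap G f)) -nat.
by rewrite !compmA (epsP b).1 comp1m.
Qed.

Definition hom3_functor : contrafunctor IGR IBSL_reduct.
Proof.
refine (@Contrafunctor IGR IBSL_reduct hom3_ibsl
  (fun A B f => exist _ _ (hom3_pull_reduct (proj2_sig f))) _ _).
- by move=> A; apply: chom_eq; apply/funext => p; exact: grHom3_eq.
- by move=> A B C g f; apply: chom_eq; apply/funext => p; exact: grHom3_eq.
Defined.

Definition hom3_functor0 : contrafunctor IGR0 IBSL.
Proof.
refine (@Contrafunctor IGR0 IBSL hom3_ibsl
  (fun A B f => exist _ _ (hom3_pull_ibsl (proj2_sig f))) _ _).
- by move=> A; apply: chom_eq; apply/funext => p; exact: grHom3_eq.
- by move=> A B C g f; apply: chom_eq; apply/funext => p; exact: grHom3_eq.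
Defined.

Definition bdual_functor : contrafunctor IBSL_reduct IGR.
Proof.
refine (@Contrafunctor IBSL_reduct IGR bdual_igr
  (fun A B f => exist _ _ (bdual_pull_igr (proj2_sig f))) _ _).
- by move=> A; apply: chom_eq; apply/funext => h; exact: bdual_eq.
- by move=> A B C g f; apply: chom_eq; apply/funext => h; exact: bdual_eq.
Defined.

Definition bdual_functor0 : contrafunctor IBSL IGR0.
Proof.
refine (@Contrafunctor IBSL IGR0 bdual_igr
  (fun A B f => exist _ _ (bdual_pull_igr0 (proj2_sig f))) _ _).
- by move=> A; apply: chom_eq; apply/funext => h; exact: bdual_eq.
- by move=> A B C g f; apply: chom_eq; apply/funext => h; exact: bdual_eq.
Defined.

Theorem theorem4p17 :
  dually_equivalent IGR IBSL_reduct /\ dually_equivalent IGR0 IBSL.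
Proof.
split.
  exists hom3_functor, bdual_functor.
  split; apply: naturally_isomorphic_sym.
    exists (fun A => exist _ _ (igr_unit_hom A)); split=> [A B f|A].
      by apply: chom_eq; apply/funext => a; exact: bdual_eq.
    exists (exist _ _ (igr_counit_hom A)).
    by split; apply: chom_eq; apply/funext;
      [exact: igr_unitK|exact: igr_counitK].
  exists (fun B => exist _ _ (ibsl_unit_reduct B)); split=> [A B f|B].
    by apply: chom_eq; apply/funext => b; exact: grHom3_eq.
  exists (exist _ _ (ibsl_counit_reduct B)).
  by split; apply: chom_eq; apply/funext;
    [exact: ibsl_unitK|exact: ibsl_counitK].
exists hom3_functor0, bdual_functor0.
split; apply: naturally_isomorphic_sym.
  exists (fun A => exist _ _ (igr_unit_hom0 A)); split=> [A B f|A].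
    by apply: chom_eq; apply/funext => a; exact: bdual_eq.
  exists (exist _ _ (igr_counit_hom0 A)).
  by split; apply: chom_eq; apply/funext; [exact: igr_unitK|exact: igr_counitK].
exists (fun B => exist _ _ (ibsl_unit_hom B)); split=> [A B f|B].
  by apply: chom_eq; apply/funext => b; exact: grHom3_eq.
exists (exist _ _ (ibsl_counit_hom B)).
by split; apply: chom_eq; apply/funext; [exact: ibsl_unitK|exact: ibsl_counitK].
Qed.
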